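(* Let $\alpha\ge 0$, $1\le s\le\infty$, $1\le p\le\infty$, $\mu>1-1/s$, $\mu>0$ (with $1/\infty=0$). Let $\theta>0$ satisfy $\theta>\mu+1/s-1$, let $\nu=\{\nu_k^N\}$ be the triangular array of a method in the class $\mathcal S^\theta$ with constant $C(\nu)$, and let $0<a\le b$. Then there is a constant $c>0$, depending only on $\alpha,\mu,s,\theta,C(\nu),a,b$, such that the following holds. For every $0<\delta<1$, every integer $N\ge 1$ with $a\,\delta^{-\frac{1}{\mu-1/p+1/s}}\le N\le b\,\delta^{-\frac{1}{\mu-1/p+1/s}}$, every $f\in W^\mu_s$ with $\|f\|_{s,\mu}\le 1$, and every real sequence $\mathbf f^\delta=(f^\delta_k)_{k\in\mathbb N_0}$ satisfying $\|(\langle f,\ell_k^{(\alpha)}\rangle-f^\delta_k)_{k}\|_{\ell_p}\le\delta$, $$\|(f-S_N^\nu f^\delta)\sqrt w\|_C\le c\,\delta^{\frac{\mu+1/s-1}{\mu-1/p+1/s}},$$ and moreover $\delta^{\frac{\mu+1/s-1}{\mu-1/p+1/s}}\asymp N^{-\mu-1/s+1}$ for such $\delta$ and $N$ (with constants of the same kind).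
   Context: Let $w(t)=t^\alpha e^{-t}$ on $(0,\infty)$, and let $L_{2,w}$ be the real Hilbert space of functions square-summable with weight $w$, with $\langle f,g\rangle=\int_0^\infty t^\alpha e^{-t}f(t)g(t)\,dt$. The Laguerre polynomials are $L_k^{(\alpha)}(t)=\sum_{m=0}^k\frac{\Gamma(k+\alpha+1)}{\Gamma(m+\alpha+1)(k-m)!}\frac{(-t)^m}{m!}$, and $\ell_k^{(\alpha)}=\left(\frac{k!}{\Gamma(k+\alpha+1)}\right)^{1/2}L_k^{(\alpha)}$, $k\in\mathbb N_0=\{0,1,2,\dots\}$, are the orthonormal ones. $C$ is the space of real-valued continuous functions on $(0,\infty)$, with $\|g\|_C=\sup_{t>0}|g(t)|\in[0,\infty]$. $\ell_p$ is the usual sequence space on $\mathbb N_0$. For $\mu>0$ and $\underline k=\max\{1,k\}$, $W^\mu_s$ is the set of $f\in L_{2,w}$ with $\|f\|_{s,\mu}<\infty$, where $\|f\|_{s,\mu}^s=\sum_{k=0}^\infty\underline k^{s\mu}|\langle f,\ell_k^{(\alpha)}\rangle|^s$ for $1\le s<\infty$ and $\|f\|_{\infty,\mu}=\sup_{k\in\mathbb N_0}\underline k^{\mu}|\langle f,\ell_k^{(\alpha)}\rangle|$. For $\mu>1-1/s$ and $f\in W^\mu_s$, the series $\sum_k\langle f,\ell_k^{(\alpha)}\rangle\ell_k^{(\alpha)}\sqrt w$ converges absolutely and uniformly, and $f\sqrt w$ is identified with its continuous representative (the sum). For a triangular array of reals $\nu=\{\nu_k^N\}$, $k=0,\dots,N$,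 $N\in\mathbb N$, and a real sequence $\mathbf f^\delta=(f^\delta_k)$ (perturbed Fourier–Laguerre coefficients), $S_N^\nu f^\delta=\sum_{k=0}^N\nu_k^N f^\delta_k\,\ell_k^{(\alpha)}$. For $\theta>0$ the method belongs to the class $\mathcal S^\theta$ if there is $C(\nu)>0$ such that $|1-\nu_k^N|\le C(\nu)(k/N)^\theta$ for all $N\in\mathbb N$, $0\le k\le N$ (with $0^\theta=0$). $A\asymp B$ means each of $A,B$ is bounded by a positive constant times the other. *)

(* Defs.v *)
From HB Require Import structures.
From mathcomp Require Import all_boot all_order all_algebra.
From mathcomp Require Import all_classical all_reals all_analysis.
Set Implicit Arguments.
Unset Strict Implicit.
Unset Printing Implicit Defensive.
Import Order.TTheory GRing.Theory Num.Theory.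
Import numFieldNormedType.Exports.
Local Open Scope classical_set_scope.
Local Open Scope ring_scope.

Definition posR (R : realType) : set R := [set` `]0, +oo[%R].
Arguments posR R : clear implicits.

(* Euler's integral; only used (and only convergent) at positive arguments. *)
Definition Gamma (R : realType) (x : R) : R :=
  \int[lebesgue_measure]_(t in posR R) (t `^ (x - 1) * expR (- t)).

Definition weight (R : realType) (alpha t : R) : R := t `^ alpha * expR (- t).

(* Elements of the space L_{2,w} are represented by functions; the values outside
   (0,+oo) are irrelevant. *)
Definition L2w (R : realType) (alpha : R) : set (R -> R) :=
  [set f : R -> R | measurable_fun (posR R) f /\
    (\int[lebesgue_measure]_(t in posR R) (weight alpha t * f t ^+ 2)%:E
      < +oo)%E].

Definition innerw (R : realType) (alpha : R) (f g : R -> R) : R :=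
  \int[lebesgue_measure]_(t in posR R) (weight alpha t * f t * g t).

Definition laguerre (R : realType) (alpha : R) (k : nat) (t : R) : R :=
  \sum_(0 <= m < k.+1)
    Gamma (k%:R + alpha + 1) / (Gamma (m%:R + alpha + 1) * (k - m)`!%:R)
    * ((- t) ^+ m / m`!%:R).

Definition laguerre_on (R : realType) (alpha : R) (k : nat) (t : R) : R :=
  Num.sqrt (k`!%:R / Gamma (k%:R + alpha + 1)) * laguerre alpha k t.

Definition FL_coef (R : realType) (alpha : R) (f : R -> R) (k : nat) : R :=
  innerw alpha f (laguerre_on alpha k).

(* 1 / s for an exponent s in [1, +oo], with 1 / +oo = 0. *)
Definition recip (R : realType) (s : \bar R) : R := fine (s^-1)%E.

Definition lp_norm (R : realType) (p : \bar R) (u : nat -> R) : \bar R :=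
  Lnorm (@counting nat R) p (EFin \o u).

(* The value at s = -oo is a dummy: only s >= 1 is used. *)
Definition W_norm (R : realType) (alpha : R) (s : \bar R) (mu : R)
    (f : R -> R) : \bar R :=
  match s with
  | r%:E => ((\sum_(0 <= k <oo)
        ((maxn 1 k)%:R `^ (r * mu) * `|FL_coef alpha f k| `^ r)%:E) `^ r^-1)%E
  | +oo%E =>
      ereal_sup (range (fun k : nat =>
        ((maxn 1 k)%:R `^ mu * `|FL_coef alpha f k|)%:E))
  | -oo%E => 0%E
  end.

Definition W (R : realType) (alpha : R) (s : \bar R) (mu : R) : set (R -> R) :=
  [set f : R -> R | L2w alpha f /\ (W_norm alpha s mu f < +oo)%E].

(* The continuous representative of f * sqrt w: the pointwise sum of the
   Fourier-Laguerre series times sqrt w, which converges (absolutely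
   and uniformly on (0,+oo)) for f in W alpha s mu when mu > 1 - 1/s. *)
Definition cont_rep (R : realType) (alpha : R) (f : R -> R) (t : R) : R :=
  limn (series (fun k =>
    FL_coef alpha f k * laguerre_on alpha k t * Num.sqrt (weight alpha t))).

Definition S_method (R : realType) (alpha : R) (nu : nat -> nat -> R) (N : nat)
    (fd : nat -> R) (t : R) : R :=
  \sum_(0 <= k < N.+1) nu N k * fd k * laguerre_on alpha k t.

(* Membership in the class S^theta with constant C; nu N k is nu_k^N, and its
   values for N = 0 or k > N play no role. *)
Definition class_S (R : realType) (theta C : R) (nu : nat -> nat -> R) : Prop :=
  forall N k : nat, (0 < N)%N -> (k <= N)%N ->
    `|1 - nu N k| <= C * (k%:R / N%:R) `^ theta.

Definition normC (R : realType) (g : R -> R) : \bar R :=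
  ereal_sup [set (`|g t|)%:E | t in posR R].

(* Main.v *)
(** Everything rests on the uniform bound [|l_k sqrt w| <= B alpha] for the orthonormal
    Laguerre functions.  With [D = t d/dt], the function [y = l_n sqrt w] satisfies
    [D^2 y + Q y = 0], where [Q = k t - t^2/4 - alpha^2/4] and [k = n + (alpha+1)/2].
    For [k t <= alpha^2 + 1] the explicit coefficients bound [y] and [D y].  Beyond, the
    energy [t^(-1/2) ((Dy + y/4)^2 + (Q + 1/16) y^2)], corrected by a factor
    [exp (alpha^2/(k t))], is nonincreasing, hence [O(sqrt k)].  This bounds [y] wherever [Q]
    is of order at least [min (k t, k)], it bounds the derivative of [y^2] on the remaining
    bounded interval before the turning point, and past the turning point [y^2] decreases.

    The error then splits into [sum_(k <= N) (1 - nu_k) f_k l_k], the noise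
    [sum_(k <= N) nu_k (f_k - fd_k) l_k] and the tail [sum_(k > N) f_k l_k].  A power-mean
    bound on blocks of indices, summed over dyadic blocks, bounds the first and the third by
    [N^(-sigma)], [sigma = mu + 1/s - 1], and the second by [delta N^(1 - 1/p)]. *)

Require Import Defs.
From HB Require Import structures.
From mathcomp Require Import all_boot all_order all_algebra.
From mathcomp Require Import all_classical all_reals all_analysis.
From mathcomp Require Import ring lra.
From mathcomp Require Import measurable_realfun ess_sup_inf.
Import Order.TTheory GRing.Theory Num.Theory.
Import numFieldNormedType.Exports.
Local Open Scope classical_set_scope.
Local Open Scope ring_scope.
Set Implicit Arguments.
Unset Strict Implicit.
Unset Printing Implicit Defensive.

(** * Euler's integral: integrability, positivity and functional equation of [Gamma] *)

(** With [n + 1 >= p], the exponential series gives [exp (t/2) >= (t/2)^(n+1) / (n+1)!], which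
    controls [t^p] for [t >= 1]. The summand [1] of the constant takes care of [t <= 1], where
    [t^p <= 1]. *)
Lemma powR_expR_bounded (R : realType) (p : R) : 0 <= p ->
  exists2 K : R, 0 < K & forall t, 0 <= t -> t `^ p * expR (- (t / 2)) <= K.
Proof.
move=> p0; pose n := Num.truncn p.
have pn : p <= n.+1%:R by rewrite ltW// /n; apply: Num.Theory.truncnS_gt.
have pn0 : (0 : R) < 2 ^+ n.+1 * n.+1`!%:R by rewrite mulr_gt0 ?exprn_gt0// ltr0n fact_gt0.
exists (1 + 2 ^+ n.+1 * n.+1`!%:R); first by rewrite addr_gt0.
move=> t t0.
rewrite expRN ler_pdivrMr ?expR_gt0//.
have e1 : 1 <= expR (t / 2) by rewrite -[leLHS]expR0 ler_expR divr_ge0.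
have th0 : 0 <= t / 2 by rewrite divr_ge0.
have en := expR_ge1Dxn n th0.
have [t1|t1] := leP t 1.
  have : t `^ p <= 1.
    have [->|tN0] := eqVneq t 0.
      have [->|pN] := eqVneq p 0; first by rewrite powRr0.
      by rewrite powR0.
    by rewrite -(powRr0 t) ger_powR// lt_neqAle eq_sym tN0 t0.
  by move=> h; apply: (le_trans h); rewrite mulrDl mul1r (le_trans e1)// lerDl mulr_ge0// ?expR_ge0 ?ltW.
apply: (@le_trans _ _ (t ^+ n.+1)).
  by rewrite -powR_mulrn// ler_powR// ltW.
rewrite mulrDl; apply: (@le_trans _ _ (2 ^+ n.+1 * n.+1`!%:R * expR (t / 2))); last first.
  by rewrite mul1r lerDr expR_ge0.
rewrite -ler_pdivrMl//; apply: le_trans en.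
by rewrite expr_div_n mulrC invfM mulrA lerDr.
Qed.

Lemma cvgy_powR_expR (R : realType) (p : R) : 0 <= p ->
  t `^ p * expR (- t) @[t --> +oo] --> (0 : R).
Proof.
move=> p0; have [K K0 HK] := @powR_expR_bounded R p p0.
have H : K * expR (- (2^-1 * t)) @[t --> +oo] --> (0 : R).
  rewrite -(mulr0 K); apply: cvgMr.
  apply: (@cvg_comp _ _ _ (fun t : R => 2^-1 * t) (fun z => expR (- z)) _ (pinfty_nbhs R)); last exact: cvgr_expR.
  exact: gt0_cvgMry.
apply: (squeeze_cvgr _ (cvg_cst 0) H).
near=> t; have t0 : 0 <= t by near: t; exact: nbhs_pinfty_ge.
rewrite mulr_ge0 ?powR_ge0 ?expR_ge0//=.
rewrite (_ : expR (- t) = expR (- (t / 2)) * expR (- (2^-1 * t))); last first.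
  by rewrite -expRD; congr expR; lra.
by rewrite mulrA ler_wpM2r ?expR_ge0// HK.
Unshelve. all: by end_near. Qed.

Lemma derivable_cvg (R : realType) (f : R -> R) (t : R) :
  derivable f t 1 -> f x @[x --> t] --> f t.
Proof. by move=> /derivable1_diffP/differentiable_continuous. Qed.

Lemma continuous_within_powR_expR (R : realType) (p : R) : 0 <= p ->
  {within `[0, +oo[, continuous (fun t : R => t `^ p * expR (- t))}.
Proof.
move=> p0; apply/continuous_within_itvcyP; split.
  move=> t; rewrite in_itv/= andbT => t0; apply: derivable_cvg.
  by apply: derivableM => //; apply: derivable_powR; rewrite in_itv/= t0.
apply: cvgM.
  have [->|pN] := eqVneq p 0.
    rewrite powRr0; under eq_fun do rewrite powRr0; exact: cvg_cst.
  rewrite powR0//; apply: powR_cvg0; by rewrite lt_neqAle eq_sym pN.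
apply: cvg_at_right_filter; apply: (@derivable_cvg _ (fun x => expR (- x))).
by [].
Qed.

Lemma integral_expR_half (R : realType) (K : R) : 0 <= K ->
  (\int[lebesgue_measure]_(t in `[0%R, +oo[) (K * expR (- (t / 2)))%:E = (2 * K)%:E)%E.
Proof.
move=> K0.
rewrite (@ge0_continuous_FTC2y R _ (fun t => - (2 * K) * expR (- (t / 2))) 0 0).
- by rewrite mul0r oppr0 expR0 mulr1 -EFinD add0r opprK.
- by move=> x _; rewrite mulr_ge0// expR_ge0.
- by apply: continuous_subspaceT => x; apply: (@derivable_cvg _ (fun x => K * expR (- (x / 2)))).
- rewrite -(mulr0 (- (2 * K))); apply: cvgMr.
  apply: (@cvg_comp _ _ _ (fun t : R => t / 2) (fun z => expR (- z)) _ (pinfty_nbhs R)); last exact: cvgr_expR.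
  exact: gt0_cvgMly.
- by [].
- by apply: cvg_at_right_filter; apply: (@derivable_cvg _ (fun t => - (2 * K) * expR (- (t / 2)))).
- move=> x _; rewrite derive1E.
  have Hd : is_derive x 1 (fun t => - (2 * K) * expR (- (t / 2))) (K * expR (- (x / 2))).
    by apply: trigger_derive; rewrite /GRing.scale/=; field.
  by rewrite derive_val.
Qed.

Lemma integrable_expR_half (R : realType) (K : R) : 0 <= K ->
  lebesgue_measure.-integrable `[0, +oo[ (EFin \o (fun t : R => K * expR (- (t / 2)))).
Proof.
move=> K0; apply/integrableP; split.
  apply/measurable_EFinP; apply: subspace_continuous_measurable_fun => //.
  by apply: continuous_subspaceT => x; apply: (@derivable_cvg _ (fun x => K * expR (- (x / 2)))).
under eq_integral do rewrite /= ger0_norm ?mulr_ge0 ?expR_ge0//.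
by rewrite integral_expR_half ?ltry.
Qed.

Lemma integrable_powR_expR (R : realType) (p : R) : 0 <= p ->
  lebesgue_measure.-integrable `[0, +oo[ (EFin \o (fun t : R => t `^ p * expR (- t))).
Proof.
move=> p0; have [K K0 HK] := @powR_expR_bounded R p p0.
have iK := integrable_expR_half (ltW K0).
apply: (le_integrable _ _ _ iK) => //.
  apply/measurable_EFinP; apply: subspace_continuous_measurable_fun => //.
  exact: continuous_within_powR_expR.
move=> t; rewrite /= in_itv/= andbT => t0.
rewrite lee_fin !ger0_norm ?mulr_ge0 ?expR_ge0 ?powR_ge0 ?(ltW K0)//.
rewrite (_ : expR (- t) = expR (- (t / 2)) * expR (- (t / 2))); last first.
  by rewrite -expRD; congr expR; lra.
by rewrite mulrA ler_wpM2r ?expR_ge0// HK.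
Qed.

(** The fundamental theorem of calculus is applied on the closed half-line; for [x >= 1] the
    integrand is integrable up to [0], so the endpoint may be added. *)
Lemma GammaE (R : realType) (x : R) : 1 <= x ->
  Gamma x = \int[lebesgue_measure]_(t in `[0%R, +oo[) (t `^ (x - 1) * expR (- t)).
Proof.
move=> x1; rewrite /Gamma /posR; apply: Rintegral_itv_obnd_cbnd.
apply: (integrableS _ _ _ (@integrable_powR_expR R (x - 1) _)) => //; last lra.
by move=> t /=; rewrite !in_itv/= !andbT; exact: ltW.
Qed.

(** On [[1, 2]] the integrand is at least [exp (-2)], and elsewhere it is nonnegative. *)
Lemma Gamma_gt0 (R : realType) (x : R) : 1 <= x -> 0 < Gamma x.
Proof.
move=> x1; rewrite GammaE//.
have x10 : 0 <= x - 1 by lra.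
have i1 := @integrable_powR_expR R _ x10.
apply: fine_gt0; apply/andP; split; last first.
  by apply: (integral_fune_lt_pinfty _ i1); exact: measurable_itv.
apply: (@lt_le_trans _ _ (\int[lebesgue_measure]_(t in `[1%R, 2%R]) (expR (-2 : R))%:E)%E).
  by rewrite integral_cst//= lebesgue_measure_itv/= lte_fin ltr1n -EFinD lte_fin mulr_gt0 ?expR_gt0//; lra.
apply: (@le_trans _ _ (\int[lebesgue_measure]_(t in `[1%R, 2%R]) (t `^ (x - 1) * expR (- t))%:E)%E).
  have sub : ([set` `[1%R, 2%R]] : set R) `<=` [set` `[0%R, +oo[].
    by move=> t /=; rewrite !in_itv/= => /andP[? _]; rewrite andbT; lra.
  apply: ge0_le_integral => //.
    by have /measurable_int := i1; apply: measurable_funS.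
  move=> t /=; rewrite in_itv/= => /andP[t1 t2]; rewrite lee_fin.
  have e1 : 1 <= t `^ (x - 1) by rewrite -[leLHS](powRr0 (t : R)) ler_powR.
  apply: (le_trans (y := 1 * expR (- t))); first by rewrite mul1r ler_expR lerN2.
  by rewrite ler_wpM2r ?expR_ge0.
apply: ge0_subset_integral => //.
- by have /measurable_int := i1.
- by move=> t _; rewrite lee_fin mulr_ge0 ?powR_ge0 ?expR_ge0.
- by move=> t /=; rewrite !in_itv/= => /andP[? _]; rewrite andbT; lra.
Qed.

(** Integration by parts: [t^x exp (-t)] vanishes at [0] and at infinity, so its derivative
    [x t^(x-1) exp (-t) - t^x exp (-t)] integrates to zero. *)
Lemma GammaS (R : realType) (x : R) : 1 <= x -> Gamma (x + 1) = x * Gamma x.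
Proof.
move=> x1; rewrite !GammaE//; last lra.
have x10 : 0 <= x - 1 by lra.
have x0 : 0 <= x by lra.
have [K K0 HK] := @powR_expR_bounded R _ x10.
have i1 := @integrable_powR_expR R _ x10.
have i2 := @integrable_powR_expR R _ x0.
have xK0 : 0 <= x * K by rewrite mulr_ge0// ltW.
have iK : lebesgue_measure.-integrable `[0, +oo[ (EFin \o (fun t : R => (x * K) * expR (- (t / 2)))).
  exact: integrable_expR_half.
(* The library's fundamental theorem on [0, +oo[ needs a nonnegative integrand, hence the
   extra term [x K exp (- t / 2)]. *)
have E : \int[lebesgue_measure]_(t in `[0%R, +oo[)
    ((x * K) * expR (- (t / 2)) - x * (t `^ (x - 1) * expR (- t)) + t `^ x * expR (- t)) = 2 * (x * K).
  rewrite (@Rintegral_ge0_continuous_FTC2y R _ (fun t => - (2 * (x * K)) * expR (- (t / 2)) - t `^ x * expR (- t)) 0 0).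
  - rewrite mul0r oppr0 expR0 powR0; last by rewrite gt_eqF//; lra.
    by rewrite mul0r subr0 mulr1 sub0r opprK.
  - move=> t t0; rewrite addr_ge0//; last by rewrite mulr_ge0 ?powR_ge0 ?expR_ge0.
    rewrite subr_ge0 -mulrA ler_wpM2l//.
    rewrite (_ : expR (- t) = expR (- (t / 2)) * expR (- (t / 2))); last first.
      by rewrite -expRD; congr expR; lra.
    by rewrite mulrA ler_wpM2r ?expR_ge0// HK.
  - apply/continuous_within_itvcyP; split.
      move=> t; rewrite in_itv/= andbT => t0; apply: derivable_cvg.
      apply: derivableD; last first.
        by apply: derivableM => //; apply: derivable_powR; rewrite in_itv/= t0.
      apply: derivableB => //.
      apply: derivableM => //.
      by apply: derivableM => //; apply: derivable_powR; rewrite in_itv/= t0.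
    apply: cvgD; last first.
      by have /continuous_within_itvcyP[] := continuous_within_powR_expR x0.
    apply: cvgB.
      by apply: cvg_at_right_filter; apply: (@derivable_cvg _ (fun t => x * K * expR (- (t / 2)))).
    apply: cvgMr.
    by have /continuous_within_itvcyP[] := continuous_within_powR_expR x10.
  - rewrite (_ : 0 = - (2 * (x * K)) * 0 - 0); last by lra.
    apply: cvgB; last exact: cvgy_powR_expR.
    apply: cvgMr.
    apply: (@cvg_comp _ _ _ (fun t : R => t / 2) (fun z => expR (- z)) _ (pinfty_nbhs R)); last exact: cvgr_expR.
    exact: gt0_cvgMly.
  - move=> t t0; apply: derivableB => //.
    by apply: derivableM => //; apply: derivable_powR; rewrite in_itv/= t0.
  - apply: cvgB.
      by apply: cvg_at_right_filter; apply: (@derivable_cvg _ (fun t => - (2 * (x * K)) * expR (- (t / 2)))).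
    by have /continuous_within_itvcyP[] := continuous_within_powR_expR x0.
  - move=> t; rewrite in_itv/= andbT => t0; rewrite derive1E.
    have Hp := is_derive1_powR x t0.
    have Hd : is_derive t 1 (fun t => - (2 * (x * K)) * expR (- (t / 2)) - t `^ x * expR (- t))
       ((x * K) * expR (- (t / 2)) - x * (t `^ (x - 1) * expR (- t)) + t `^ x * expR (- t)).
      by apply: trigger_derive; rewrite /GRing.scale/=; field.
    by rewrite derive_val.
have ix : lebesgue_measure.-integrable `[0, +oo[ (EFin \o (fun t : R => x * (t `^ (x - 1) * expR (- t)))).
  by apply: (integrableZl _ x i1); exact: measurable_itv.
have ib : lebesgue_measure.-integrable `[0, +oo[
    (EFin \o (fun t : R => x * K * expR (- (t / 2)) - x * (t `^ (x - 1) * expR (- t)))).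
  by apply: (integrableB _ iK ix); exact: measurable_itv.
move: E; rewrite RintegralD// RintegralB// [X in _ - X + _]RintegralZl//.
have -> : \int[lebesgue_measure]_(t in `[0%R, +oo[) (x * K * expR (- (t / 2))) = 2 * (x * K).
  by rewrite /Rintegral integral_expR_half.
by rewrite addrK => /eqP; rewrite -addrA -subr_eq0 addrAC subrr add0r addrC subr_eq0 => /eqP.
Qed.

(** * Mean value estimates and rules of differentiation *)

Lemma le_of_derive_le (R : realType) (f df : R -> R) (a b c : R) : a <= b ->
  (forall x, a <= x <= b -> is_derive x 1 f (df x)) ->
  (forall x, a <= x <= b -> df x <= c) -> f b <= f a + c * (b - a).
Proof.
move=> ab fdf dfc; rewrite -lerBlDl.
have [||x xab ->] := @MVT_segment R f df a b ab.
- by move=> x /subset_itv_oo_cc; rewrite in_itv/= => /fdf.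
- apply: derivable_within_continuous => x; rewrite in_itv/= => /fdf h.
  exact: ex_derive.
- by rewrite ler_wpM2r ?subr_ge0// dfc// -[_ <= _ <= _]/(x \in `[a, b]).
Qed.

Lemma le_of_derive_ge0 (R : realType) (f df : R -> R) (a b : R) : a <= b ->
  (forall x, a <= x <= b -> is_derive x 1 f (df x)) ->
  (forall x, a <= x <= b -> 0 <= df x) -> f a <= f b.
Proof.
move=> ab fdf df0.
have := @le_of_derive_le R (fun x => - f x) (fun x => - df x) a b 0 ab.
rewrite mul0r addr0 lerN2; apply => x xab; first exact: (is_deriveN (fdf x xab)).
by rewrite oppr_le0 df0.
Qed.

(** This rule and the next ones are stated for eta-expanded functions with ordinary products, so
    that the derivative of a composite expression can be assembled as a term and then normalized by
    [field]. *)
Lemma is_derive_add (R : realType) (f g : R -> R) (x a b : R) :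
  is_derive x 1 f a -> is_derive x 1 g b -> is_derive x 1 (fun t : R => f t + g t) (a + b).
Proof. exact: is_deriveD. Qed.

Lemma is_derive_mul (R : realType) (f g : R -> R) (x a b : R) :
  is_derive x 1 f a -> is_derive x 1 g b ->
  is_derive x 1 (fun t : R => f t * g t) (a * g x + f x * b).
Proof.
move=> fa gb; have := is_deriveM fa gb.
by rewrite /GRing.scale/= addrC [g x * a]mulrC.
Qed.

Lemma is_derive_sqr (R : realType) (f : R -> R) (x a : R) :
  is_derive x 1 f a -> is_derive x 1 (fun t : R => f t ^+ 2) (2 * f x * a).
Proof.
by move=> fa; apply: (trigger_derive (is_derive_mul fa fa)); ring.
Qed.

Lemma is_derive_exp (R : realType) (f : R -> R) (x a : R) :
  is_derive x 1 f a -> is_derive x 1 (fun t : R => expR (f t)) (a * expR (f x)).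
Proof.
by move=> fa; have := is_derive1_comp (is_derive_expR (f x)) fa; rewrite mulrC.
Qed.

Lemma is_derive_inv (R : realType) (x : R) : 0 < x ->
  is_derive x 1 (fun t : R => t^-1) (- (x^-1 / x)).
Proof.
move=> x0; have xN0 : x != 0 by rewrite gt_eqF.
have := @is_deriveV _ id x 1 1 xN0 (is_derive_id x 1).
by rewrite /GRing.scale/= mulr1 expr2 invfM.
Qed.

Lemma is_derive_powR_div (R : realType) (a x : R) : 0 < x ->
  is_derive x 1 (fun t : R => t `^ a) (a * (x `^ a / x)).
Proof.
move=> x0; have := is_derive1_powR a x0.
by rewrite powRB ?powRr1 ?(ltW x0)// (gt_eqF x0) implybT.
Qed.

(** * Uniform bound for decaying solutions of the equation of the Laguerre functions *)

Section second_order_ode.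
Context {R : realType} (al k A : R) (Y Y1 : R -> R).
Let Q (t : R) := k * t - t ^+ 2 / 4 - al ^+ 2 / 4.
Hypotheses (al0 : 0 <= al) (kal : (al + 1) / 2 <= k).
Hypothesis dY : forall t : R, 0 < t -> is_derive t 1 Y (Y1 t / t).
Hypothesis dY1 : forall t : R, 0 < t -> is_derive t 1 Y1 (- (Q t * Y t) / t).
(** Singles out the solutions that are recessive at infinity; it serves to exclude growth of [|Y|]
    past the turning point. *)
Hypothesis Ydecay : exists C, forall t : R, 0 < t -> t * `|Y t| <= C.
(** The point [c / k] separates the region of the explicit coefficients from that of the energy:
    beyond it [al^2 / (k t) <= 1], and [Q t >= k t / 4] as long as [t <= 2 k]. *)
Let c := al ^+ 2 + 1.
Hypothesis Yinit : forall t : R, 0 < t -> k * t <= c -> Y t ^+ 2 <= A ^+ 2 /\ Y1 t ^+ 2 <= A ^+ 2.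

(** [V] is [t^(1/4) / 2] times the derivative of [t^(1/4) Y] with respect to [sqrt t]. *)
Let V t := Y1 t + Y t / 4.
(* [H] is, up to a constant, the energy [phi'^2 + R phi^2] of the Liouville normal form
   [phi'' + R phi = 0], in the variable [sqrt t] with [phi = t^(1/4) Y]; the factor in [K]
   absorbs, as in Groenwall's lemma, the region [t < al] where [H] may increase. *)
Let H t := (V t ^+ 2 + (Q t + 16^-1) * Y t ^+ 2) * t `^ (- 2^-1).
Let K t := H t * expR (al ^+ 2 / k * t^-1).
(** [M sqrt k] bounds [K (c / k)]: the factor [(c + 2) A^2] comes from the energy at [c / k], the
    factor [e] from the exponential correction. *)
Let M := expR 1 * ((c + 2) * A ^+ 2).

Let k0 : 0 < k. Proof. move: al0 kal; lra. Qed.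
Let c1 : 1 <= c. Proof. by rewrite /c lerDr sqr_ge0. Qed.
Let M0 : 0 <= M.
Proof. by rewrite mulr_ge0 ?expR_ge0// mulr_ge0 ?sqr_ge0//; move: c1; lra. Qed.

Let dQ (t : R) : is_derive t 1 Q (k - t / 2).
Proof. by apply: trigger_derive; rewrite /GRing.scale/=; field. Qed.

Let dV (t : R) : 0 < t -> is_derive t 1 V ((Y1 t / 4 - Q t * Y t) / t).
Proof.
move=> t0; have tN0 : t != 0 by rewrite gt_eqF.
apply: (trigger_derive (is_derive_add (dY1 t0) (is_derive_mul (dY t0) (is_derive_cst (4^-1 : R) t 1)))).
by rewrite /cst; field.
Qed.

Let dK (t : R) : 0 < t -> is_derive t 1 K
  (t `^ (- 2^-1) / t * expR (al ^+ 2 / k * t^-1) *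
    ((al ^+ 2 / 4 - t ^+ 2 / 4 - 16^-1) * Y t ^+ 2
     - al ^+ 2 / k * t^-1 * (V t ^+ 2 + (Q t + 16^-1) * Y t ^+ 2))).
Proof.
move=> t0; have tN0 : t != 0 by rewrite gt_eqF.
have kN0 : k != 0 by rewrite gt_eqF.
have dH := is_derive_mul
  (is_derive_add (is_derive_sqr (dV t0))
    (is_derive_mul (is_derive_add (dQ t) (is_derive_cst (16^-1 : R) t 1))
                   (is_derive_sqr (dY t0))))
  (is_derive_powR_div (- 2^-1) t0).
have dE := is_derive_exp (is_derive_mul (is_derive_cst (al ^+ 2 / k) t 1) (is_derive_inv t0)).
apply: (trigger_derive (is_derive_mul dH dE)).
rewrite /cst /V /Q.
by field; rewrite tN0 kN0.
Qed.

(** Put [u = al^2 / (k x)], so [u <= 1] here. In the derivative of [K], the term [V^2] has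
    coefficient [- u]. As [u k x = al^2], the coefficient of [Y^2] is [(al^2 - x^2) / 4 - 1/16 -
    al^2 + u (x^2 + al^2) / 4 - u / 16], which is at most [- al^2 / 2]. *)
Let K_le (t : R) : c / k <= t -> K t <= K (c / k).
Proof.
move=> ct; have t00 : 0 < c / k by rewrite divr_gt0//; move: c1; lra.
have := @le_of_derive_le R K _ (c / k) t 0 ct (fun x xab => dK (lt_le_trans t00 (proj1 (andP xab)))).
rewrite mul0r addr0; apply => x /andP[cx _].
have x0 := lt_le_trans t00 cx.
have -> : al ^+ 2 / k * x^-1 = al ^+ 2 / (k * x) by rewrite invfM mulrA.
set u := al ^+ 2 / (k * x).
have kx0 : 0 < k * x by rewrite mulr_gt0.
have ckx : c <= k * x by rewrite mulrC -ler_pdivrMr.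
have u0 : 0 <= u by rewrite divr_ge0 ?sqr_ge0// ltW.
have u1 : u <= 1 by rewrite ler_pdivrMr// mul1r (le_trans _ ckx)// /c lerDl.
have uQ : u * Q x = al ^+ 2 - u * (x ^+ 2 + al ^+ 2) / 4.
  have : u * (k * x) = al ^+ 2 by rewrite divfK// gt_eqF.
  by rewrite /Q => <-; field.
rewrite pmulr_rle0; last by rewrite mulr_gt0 ?expR_gt0// divr_gt0// powR_gt0.
rewrite mulrDr mulrA mulrDr uQ.
have W0 : 0 <= u * V x ^+ 2 by rewrite mulr_ge0 ?sqr_ge0.
set y := Y x ^+ 2; have y0 : 0 <= y by rewrite sqr_ge0.
have E1 : u * (x ^+ 2 + al ^+ 2) <= x ^+ 2 + al ^+ 2.
  by rewrite ler_piMl// addr_ge0// sqr_ge0.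
suff : (al ^+ 2 / 4 - x ^+ 2 / 4 - 16^-1 - (al ^+ 2 - u * (x ^+ 2 + al ^+ 2) / 4 + u / 16)) * y <= 0 by lra.
by rewrite mulr_le0_ge0//; have := sqr_ge0 al; lra.
Qed.

Let powR_Nhalf (t : R) : 0 < t -> t `^ (- 2^-1) = (Num.sqrt t)^-1.
Proof. by move=> t0; rewrite powRN powR12_sqrt// ltW. Qed.

(** By monotonicity only the value of [K] at [c / k] matters. There [Yinit] bounds [Y] and [Y1], the
    power [t^(-1/2) = sqrt (k / c)] is at most [sqrt k], and the exponential is at most [e]. *)
Let H_le (t : R) : c / k <= t ->
  V t ^+ 2 + (Q t + 16^-1) * Y t ^+ 2 <= M * Num.sqrt k * Num.sqrt t.
Proof.
move=> ct; have t00 : 0 < c / k by rewrite divr_gt0//; move: c1; lra.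
have t0 := lt_le_trans t00 ct.
have st0 : 0 < Num.sqrt t by rewrite sqrtr_gt0.
suff : H t <= M * Num.sqrt k by rewrite /H powR_Nhalf// ler_pdivrMr.
have MK0 : 0 <= M * Num.sqrt k by rewrite mulr_ge0// sqrtr_ge0.
(* The exponential factor of [K] is at least 1, but this yields [H t <= K t] only when [H t] is
   nonnegative. *)
have [Ht|Ht] := leP (H t) 0; first exact: le_trans MK0.
have : H t <= K t.
  rewrite /K ler_peMr ?(ltW Ht)// -[leLHS]expR0 ler_expR.
  by rewrite !mulr_ge0// ?invr_ge0 ?ltW.
move/le_trans; apply; apply: (le_trans (K_le ct)).
have cN0 : c != 0 by rewrite gt_eqF//; move: c1; lra.
have kN0 : k != 0 by rewrite gt_eqF.
have [HY HY1] : Y (c / k) ^+ 2 <= A ^+ 2 /\ Y1 (c / k) ^+ 2 <= A ^+ 2.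
  by apply: Yinit => //; rewrite mulrC divfK.
rewrite /K (_ : _ / (c / k) = al ^+ 2 / c); last by field; rewrite cN0 kN0.
have B0 : 0 <= (c + 2) * A ^+ 2 by rewrite mulr_ge0 ?sqr_ge0//; move: c1; lra.
have Hc : H (c / k) <= (c + 2) * A ^+ 2 * Num.sqrt k.
  rewrite /H powR_Nhalf// ler_pdivrMr ?sqrtr_gt0// -[leRHS]mulrA -sqrtrM ?(ltW k0)//.
  have kck : k * (c / k) = c by rewrite mulrC divfK.
  rewrite kck.
  apply: (@le_trans _ _ ((c + 2) * A ^+ 2)); last first.
    by rewrite ler_peMr// -[leLHS]sqrtr1 ler_wsqrtr.
  (* The constant is [(1 + 1/4)^2]. *)
  have V2 : V (c / k) ^+ 2 <= 25 / 16 * A ^+ 2.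
    have : 0 <= (Y1 (c / k) - Y (c / k)) ^+ 2 by rewrite sqr_ge0.
    rewrite /V !expr2; move: HY HY1; rewrite !expr2; lra.
  have Qc : Q (c / k) <= c.
    rewrite /Q kck; have := sqr_ge0 (c / k); have := sqr_ge0 al; lra.
  have QY : (Q (c / k) + 16^-1) * Y (c / k) ^+ 2 <= (c + 16^-1) * A ^+ 2.
    apply: (@le_trans _ _ ((c + 16^-1) * Y (c / k) ^+ 2)).
      by rewrite ler_wpM2r ?sqr_ge0// lerD2r.
    by rewrite ler_wpM2l//; move: c1; lra.
  have := sqr_ge0 A; lra.
apply: (@le_trans _ _ ((c + 2) * A ^+ 2 * Num.sqrt k * expR (al ^+ 2 / c))).
  by rewrite ler_wpM2r ?expR_ge0.
rewrite [leRHS](_ : _ = (c + 2) * A ^+ 2 * Num.sqrt k * expR 1); last by rewrite /M; ring.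
rewrite ler_wpM2l//.
  by apply: mulr_ge0; [exact: B0|exact: sqrtr_ge0].
by rewrite ler_expR ler_pdivrMr ?mul1r /c ?lerDl//; move: c1; rewrite /c; lra.
Qed.

(** The energy bound [M sqrt (k t)] is divided by a lower bound of [Q]. For [t <= 2 k] this is
    [k t / 4], with [sqrt (k t) >= 1]; for [2 k < t <= 4 k - c] it is [k / 2], with
    [sqrt (k t) <= 2 k]. *)
Let Y_le_osc (t : R) : c / k <= t -> (t <= 2 * k) || (t <= 4 * k - c) -> Y t ^+ 2 <= 4 * M.
Proof.
move=> ct tk; have t00 : 0 < c / k by rewrite divr_gt0//; move: c1; lra.
have t0 := lt_le_trans t00 ct.
have ckt : c <= k * t by rewrite mulrC -ler_pdivrMr.
have y0 : 0 <= Y t ^+ 2 by rewrite sqr_ge0.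
have W0 : 0 <= V t ^+ 2 by rewrite sqr_ge0.
have Hl : (Q t + 16^-1) * Y t ^+ 2 <= M * Num.sqrt (k * t).
  by rewrite sqrtrM ?(ltW k0)// mulrA; have := H_le ct; lra.
have [t2k|t2k] := leP t (2 * k).
  have Qt : k * t / 4 <= Q t.
    have : t * t <= 2 * k * t by rewrite ler_pM2r.
    by rewrite /Q; move: ckt; rewrite /c !expr2; lra.
  have s1 : 1 <= Num.sqrt (k * t).
    by rewrite -[leLHS]sqrtr1 ler_wsqrtr// (le_trans c1).
  have E : k * t = Num.sqrt (k * t) ^+ 2 by rewrite sqr_sqrtr// mulr_ge0// ltW.
  have : Num.sqrt (k * t) * (Num.sqrt (k * t) / 4 * Y t ^+ 2) <= Num.sqrt (k * t) * M.
    have : k * t / 4 * Y t ^+ 2 <= (Q t + 16^-1) * Y t ^+ 2 by rewrite ler_wpM2r//; lra.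
    rewrite {1}E; lra.
  rewrite ler_pM2l; last by rewrite (lt_le_trans _ s1).
  have : 1 * Y t ^+ 2 <= Num.sqrt (k * t) * Y t ^+ 2 by rewrite ler_wpM2r.
  lra.
have {tk}tk : t <= 4 * k - c by move: tk; rewrite leNgt t2k.
have Qt : k / 2 <= Q t.
  have : 2 * k * c <= t * (4 * k - t).
    by apply: ler_pM; move: c1 k0; lra.
  have : al ^+ 2 / 2 <= k * al ^+ 2 by rewrite mulrC ler_wpM2r ?sqr_ge0//; move: al0 kal; lra.
  rewrite /Q /c !expr2; lra.
have : k * (Y t ^+ 2 / 2) <= k * (2 * M).
  have : Num.sqrt (k * t) <= 2 * k.
    rewrite -[leRHS]ger0_norm -?sqrtr_sqr; last by move: k0; lra.
    apply: ler_wsqrtr.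
    have : k * t <= k * (4 * k) by rewrite ler_pM2l//; move: c1; lra.
    rewrite expr2; lra.
  move/(ler_wpM2l M0).
  have : k / 2 * Y t ^+ 2 <= (Q t + 16^-1) * Y t ^+ 2 by rewrite ler_wpM2r//; lra.
  lra.
by rewrite ler_pM2l//; lra.
Qed.

Let A_le_M : A ^+ 2 <= M.
Proof.
have e1 : 1 <= expR 1 :> R by rewrite -[leLHS]expR0 ler_expR.
have : 1 * A ^+ 2 <= (c + 2) * A ^+ 2 by rewrite ler_wpM2r ?sqr_ge0//; move: c1; lra.
have : 1 * ((c + 2) * A ^+ 2) <= M.
  by rewrite ler_wpM2r// mulr_ge0 ?sqr_ge0//; move: c1; lra.
lra.
Qed.

Let Y_le_init : Y (c / k) ^+ 2 <= M.
Proof.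
have t00 : 0 < c / k by rewrite divr_gt0//; move: c1; lra.
apply: le_trans A_le_M; have [] // := Yinit t00.
by rewrite mulrC divfK// gt_eqF.
Qed.

(** Before the turning point only an interval of length at most [c] is left, because [Q t >= 0]
    forces [t <= 4 k]. On it the derivative of [Y^2] is at most [2 M], which adds [2 c M] to the
    bound [4 M] at its left end. *)
Let Y_le_turn (t : R) : c / k <= t -> 0 <= Q t -> Y t ^+ 2 <= (4 + 2 * c) * M.
Proof.
move=> ct Qt; have [k_gt0 c_ge1 M_ge0] := And3 k0 c1 M0; have t00 : 0 < c / k by rewrite divr_gt0//; lra.
have cM : 0 <= c * M by rewrite mulr_ge0//; lra.
have [tk|] := boolP ((t <= 2 * k) || (t <= 4 * k - c)).
  by have := Y_le_osc ct tk; lra.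
rewrite negb_or -!ltNge => /andP[t2k t4k].
(* [t1] is where the earlier bounds stop. The maximum with [c / k] covers small [k], for which [2 k]
   and [4 k - c] may lie below [c / k]; then [Y_le_init] applies. *)
pose t1 := Num.max (c / k) (Num.max (2 * k) (4 * k - c)).
have t1t : t1 <= t by rewrite /t1 !ge_max ct !ltW.
have [t1c t1k t1K] : [/\ c / k <= t1, 2 * k <= t1 & 4 * k - c <= t1].
  by rewrite /t1 !le_max !lexx !orbT.
have Yt1 : Y t1 ^+ 2 <= 4 * M.
  have : t1 = c / k \/ (t1 <= 2 * k) || (t1 <= 4 * k - c).
    have [h|h] := leP (c / k) (Num.max (2 * k) (4 * k - c)).
      by right; rewrite /t1 (max_r h) -le_max.
    by left; rewrite /t1 (max_l (ltW h)).
  by case=> [->|]; [move: Y_le_init; lra|exact: Y_le_osc].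
have t4 : t <= 4 * k.
  have : t * t <= t * (4 * k) by move: Qt (sqr_ge0 al); rewrite /Q !expr2; lra.
  by rewrite ler_pM2l// (lt_le_trans t00).
have := @le_of_derive_le R (fun s => Y s ^+ 2) _ t1 t (2 * M) t1t
  (fun x xab => is_derive_sqr (dY (lt_le_trans t00 (le_trans t1c (proj1 (andP xab)))))).
have : 2 * M * (t - t1) <= 2 * M * c by rewrite ler_wpM2l//; lra.
move=> + H1; suff : Y t ^+ 2 <= Y t1 ^+ 2 + 2 * M * (t - t1) by lra.
apply: H1 => s /andP[t1s st].
have s2k : 2 * k <= s := le_trans t1k t1s.
have s0 : 0 < s by lra.
(* [Q] is a concave parabola with axis [2 k], hence decreasing between [s] and [t]. *)
have Qs : 0 <= Q s.
  have : 0 <= (t - s) * (t + s - 4 * k) by rewrite mulr_ge0//; lra.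
  by move: Qt; rewrite /Q !expr2; lra.
rewrite mulrA ler_pdivrMr//.
have sks : Num.sqrt k * Num.sqrt s <= s.
  rewrite -sqrtrM ?(ltW k0)// -[leRHS]ger0_norm ?(ltW s0)// -sqrtr_sqr ler_wsqrtr//.
  by rewrite expr2 ler_pM2r//; lra.
have := H_le (le_trans t1c t1s).
have : M * (Num.sqrt k * Num.sqrt s) <= M * s by rewrite ler_wpM2l.
have : 0 <= (Q s + 16^-1) * Y s ^+ 2 by rewrite mulr_ge0 ?sqr_ge0//; lra.
(* This square equals [V^2 - Y Y1], so [Y Y1 <= V^2 <= M s]. *)
have : 0 <= (V s - Y s / 2) ^+ 2 by rewrite sqr_ge0.
rewrite -mulrA !expr2 /V; lra.
Qed.

(** Where [Q <= 0], the product [Y Y1] has derivative [(Y1^2 - Q Y^2) / x >= 0]. If it were positive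
    at some [s], it would stay positive, [|Y|] would not decrease after [s], and [t |Y t|] would be
    unbounded, against [Ydecay]. Hence [Y Y1 <= 0] and [Y^2] decreases. *)
Let Y_decr (a t : R) : 0 < a -> (forall s, a <= s -> Q s <= 0) -> a <= t ->
  Y t ^+ 2 <= Y a ^+ 2.
Proof.
move=> a0 Qa at_.
have YY1_le0 (s : R) : a <= s -> Y s * Y1 s <= 0.
  move=> as_; have s0 := lt_le_trans a0 as_; rewrite leNgt; apply/negP => P0.
  have Pu (u : R) : s <= u -> 0 <= Y u * Y1 u.
    move=> su; apply: (le_trans (ltW P0)).
    apply: (@le_of_derive_ge0 R (fun u => Y u * Y1 u) _ s u su
      (fun x xab => is_derive_mul (dY (lt_le_trans s0 (proj1 (andP xab))))
                                  (dY1 (lt_le_trans s0 (proj1 (andP xab)))))).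
    move=> x /andP[sx _].
    have x0 := lt_le_trans s0 sx.
    rewrite (_ : _ + _ = (Y1 x ^+ 2 - Q x * Y x ^+ 2) / x); last by field; rewrite gt_eqF.
    rewrite divr_ge0 ?(ltW x0)// subr_ge0 (le_trans _ (sqr_ge0 _))//.
    by rewrite mulr_le0_ge0 ?sqr_ge0// Qa// (le_trans as_).
  have Yu (u : R) : s <= u -> Y s ^+ 2 <= Y u ^+ 2.
    move=> su; apply: (@le_of_derive_ge0 R (fun u => Y u ^+ 2) _ s u su
      (fun x xab => is_derive_sqr (dY (lt_le_trans s0 (proj1 (andP xab)))))).
    move=> x /andP[sx _]; have x0 := lt_le_trans s0 sx.
    by rewrite mulrA divr_ge0 ?(ltW x0)// -mulrA mulr_ge0// Pu.
  have Ys : 0 < `|Y s|.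
    by rewrite normr_gt0; apply: contraTneq P0 => ->; rewrite mul0r ltxx.
  have [C HC] := Ydecay.
  pose u := Num.max s ((`|C| + 1) / `|Y s|).
  have su : s <= u by rewrite /u le_max lexx.
  have u0 := lt_le_trans s0 su.
  have := HC _ u0.
  have : u * `|Y s| <= u * `|Y u|.
    by rewrite ler_pM2l// -ler_sqr ?nnegrE// !real_normK ?num_real// Yu.
  have : `|C| + 1 <= u * `|Y s| by rewrite -ler_pdivrMr// /u le_max lexx orbT.
  have := ler_norm C; lra.
rewrite -lerN2.
apply: (@le_of_derive_ge0 R (fun u => - Y u ^+ 2) _ a t at_
      (fun x xab => is_deriveN (is_derive_sqr (dY (lt_le_trans a0 (proj1 (andP xab))))))).
move=> x /andP[ax _]; have x0 := lt_le_trans a0 ax.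
rewrite oppr_ge0 mulrA mulr_le0_ge0 ?invr_ge0 ?(ltW x0)// -mulrA.
by rewrite mulr_ge0_le0// YY1_le0.
Qed.

Lemma laguerre_ode_bound (t : R) : 0 < t -> Y t ^+ 2 <= (4 + 2 * c) * M.
Proof.
move=> t0; have [k_gt0 c_ge1 M_ge0] := And3 k0 c1 M0; have t00 : 0 < c / k by rewrite divr_gt0//; lra.
have cM : 0 <= c * M by rewrite mulr_ge0//; lra.
have [kt|kt] := leP (k * t) c.
  by have [h _] := Yinit t0 kt; have := A_le_M; lra.
have ct : c / k <= t by rewrite ler_pdivrMr// mulrC ltW.
have [Qt|Qt] := leP 0 (Q t); first exact: Y_le_turn.
have [t2k|t2k] := leP t (2 * k); first by have := Y_le_osc ct; rewrite t2k => /(_ isT); lra.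
have D0 : 0 <= 4 * k ^+ 2 - al ^+ 2.
  have : al * al <= (2 * k) * (2 * k) by rewrite ler_pM//; move: al0 kal; lra.
  by rewrite !expr2; lra.
(* [t2] is the larger root of [Q], the turning point; since [Q t < 0] and [t > 2 k], it lies to the
   left of [t]. The maximum [t3] keeps the starting point in the range [c / k <= t]. *)
pose t2 := 2 * k + Num.sqrt (4 * k ^+ 2 - al ^+ 2).
have QE (s : R) : Q s = (4 * k ^+ 2 - al ^+ 2 - (s - 2 * k) ^+ 2) / 4.
  by rewrite /Q; field.
have t2t : t2 <= t.
  rewrite /t2 -lerBrDl -[leRHS]ger0_norm -?sqrtr_sqr; last by lra.
  by apply: ler_wsqrtr; move: Qt; rewrite QE; lra.
pose t3 := Num.max (c / k) t2.
have t3t : t3 <= t by rewrite /t3 ge_max ct.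
have t3t2 : t2 <= t3 by rewrite /t3 le_max lexx orbT.
apply: (le_trans (@Y_decr t3 t _ _ t3t)).
- by rewrite /t3 lt_max t00.
- move=> s t3s; rewrite QE.
  have : Num.sqrt (4 * k ^+ 2 - al ^+ 2) <= s - 2 * k by have := le_trans t3t2 t3s; rewrite /t2; lra.
  move=> h; have := ler_pM (sqrtr_ge0 _) (sqrtr_ge0 _) h h.
  by rewrite -!expr2 sqr_sqrtr//; lra.
- have [ct2|ct2] := leP (c / k) t2; last by rewrite /t3 (max_l (ltW ct2)); have := Y_le_init; lra.
  rewrite /t3 (max_r ct2); apply: Y_le_turn => //; rewrite QE.
  have -> : t2 - 2 * k = Num.sqrt (4 * k ^+ 2 - al ^+ 2) by rewrite /t2 addrAC subrr add0r.
  by rewrite sqr_sqrtr// subrr mul0r.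
Qed.

End second_order_ode.

(** * Laguerre polynomials: coefficients, differential equation, growth *)

Lemma Gamma_natS (R : realType) (al : R) (n : nat) : 0 <= al ->
  Gamma (n.+1%:R + al + 1) = (n%:R + al + 1) * Gamma (n%:R + al + 1).
Proof.
move=> al0; rewrite -GammaS; last by have : 0 <= n%:R :> R by []; lra.
by congr Gamma; rewrite -natr1; ring.
Qed.

Lemma Gamma_nat_gt0 (R : realType) (al : R) (n : nat) : 0 <= al ->
  0 < Gamma (n%:R + al + 1).
Proof. by move=> al0; apply: Gamma_gt0; have : 0 <= n%:R :> R by []; lra. Qed.

Definition lag_coef (R : realType) (al : R) (n m : nat) : R :=
  Gamma (n%:R + al + 1) / (Gamma (m%:R + al + 1) * (n - m)`!%:R) * ((-1) ^+ m / m`!%:R).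

Definition lag_poly (R : realType) (al : R) (n : nat) : {poly R} :=
  \poly_(m < n.+1) lag_coef al n m.

Lemma laguerreE (R : realType) (al : R) n t : laguerre al n t = (lag_poly al n).[t].
Proof.
rewrite /laguerre /lag_poly horner_poly big_mkord; apply: eq_bigr => i _.
by rewrite /lag_coef (exprNn t); ring.
Qed.

(** Both the differential equation and the coefficient bounds come from this recurrence; the form
    without division makes it valid also beyond the degree. *)
Lemma lag_polyS (R : realType) (al : R) n m : 0 <= al ->
  (lag_poly al n)`_m.+1 * (m.+1%:R * (m%:R + al + 1)) = (m%:R - n%:R) * (lag_poly al n)`_m.
Proof.
move=> al0; rewrite /lag_poly !coef_poly ltnS.
have [mn|nm|->] := ltngtP m n.
- rewrite ltnS ltnW// /lag_coef Gamma_natS//.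
  have -> : (n - m = (n - m.+1).+1)%N by rewrite subnSK.
  rewrite !factS !natrM exprS.
  have -> : m%:R - n%:R = - (n - m.+1).+1%:R :> R.
    by rewrite subnSK// natrB ?opprB// ltnW.
  have h1 : Gamma (m%:R + al + 1) != 0 by rewrite gt_eqF// Gamma_nat_gt0.
  have h2 : m%:R + al + 1 != 0 by rewrite gt_eqF//; have : 0 <= m%:R :> R by []; lra.
  have h3 i : i`!%:R != 0 :> R by rewrite pnatr_eq0 -lt0n fact_gt0.
  have h4 i : i.+1%:R != 0 :> R by rewrite pnatr_eq0.
  move: h1 h2 (h3 m) (h3 (n - m.+1)%N) (h4 m) (h4 (n - m.+1)%N).
  move: ((-1) ^+ m) (m`!%:R : R) ((n - m.+1)`!%:R : R) (m.+1%:R : R) ((n - m.+1).+1%:R : R)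
    (Gamma (n%:R + al + 1)) (m%:R + al + 1) (Gamma (m%:R + al + 1)).
  move=> e f1 f2 m1 nm1 G x g hg hx hf1 hf2 hm1 hnm1.
  by field; rewrite hg hx hf1 hf2 hm1 hnm1.
- by rewrite ltnS leqNgt nm/= mul0r mulr0.
- by rewrite subrr !mul0r.
Qed.

(** Comparing the coefficients of [X^j] reduces Laguerre's equation to [lag_polyS] at [m = j]. *)
Lemma lag_poly_ode (R : realType) (al : R) n t : 0 <= al ->
  t * ((lag_poly al n)^`()^`()).[t] =
  - ((al + 1 - t) * ((lag_poly al n)^`()).[t] + n%:R * (lag_poly al n).[t]).
Proof.
move=> al0; set L := lag_poly al n.
suff /(congr1 (fun p : {poly R} => p.[t])) :
    'X * L^`()^`() = - (((al + 1)%:P - 'X) * L^`() + n%:R *: L) by rewrite !hornerE.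
apply/polyP => j; rewrite coefN coefD mulrBl coefB coefCM coefZ !coefXM !coef_deriv.
case: j => [|j] /=.
  have := lag_polyS n 0 al0; rewrite -/L; lra.
rewrite -(mulr_natr (_ *+ _) j.+1) -(mulr_natr L`_j.+2) -(mulr_natr L`_j.+1).
have := lag_polyS n j.+1 al0; rewrite -/L => h.
move: h; rewrite -[j.+2%:R]natr1.
move: (L`_j.+2) (L`_j.+1) (n%:R : R) (j.+1%:R : R) => x y N J h.
transitivity (x * ((J + 1) * (J + al + 1)) - (al + 1) * (x * (J + 1))); first by ring.
by rewrite h; ring.
Qed.

Lemma lag_poly_coef0 (R : realType) (al : R) n :
  (lag_poly al n)`_0 = Gamma (n%:R + al + 1) / (Gamma (al + 1) * n`!%:R).
Proof. by rewrite coef_poly/= /lag_coef subn0 add0r expr0 fact0 divr1 mulr1. Qed.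

Lemma lag_poly_coef0_gt0 (R : realType) (al : R) n : 0 <= al -> 0 < (lag_poly al n)`_0.
Proof.
move=> al0; rewrite lag_poly_coef0 divr_gt0 ?Gamma_nat_gt0// mulr_gt0 ?ltr0n ?fact_gt0//.
by have := Gamma_nat_gt0 0 al0; rewrite add0r.
Qed.

(** By [lag_polyS], the ratio of consecutive coefficients is at most [n / (m + 1)^2] in absolute
    value, as [|m - n| <= n] and [al >= 0]. *)
Lemma lag_poly_coef_le (R : realType) (al : R) n m : 0 <= al ->
  `|(lag_poly al n)`_m| <= (lag_poly al n)`_0 * (n%:R ^+ m / m`!%:R ^+ 2).
Proof.
move=> al0; have L0 := lag_poly_coef0_gt0 n al0.
elim: m => [|m IH].
  by rewrite fact0 expr1n expr0 divr1 mulr1 ger0_norm// ltW.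
have [nm|mn] := leqP n.+1 m.+1.
  by rewrite [X in `|X|]coef_poly ltnNge nm/= normr0 mulr_ge0// ltW.
have m1 : 0 < m.+1%:R :> R by rewrite ltr0n.
have D0 : 0 < m.+1%:R * (m%:R + al + 1) :> R by rewrite mulr_gt0//; have : 0 <= m%:R :> R by []; lra.
have /(congr1 Num.norm) := lag_polyS n m al0.
rewrite !normrM (ger0_norm (ltW m1)) (@ger0_norm _ (m%:R + al + 1)); last by have : 0 <= m%:R :> R by []; lra.
move/(canRL (mulfK (lt0r_neq0 D0))) ->.
rewrite ler_pdivrMr//.
have nm : `|m%:R - n%:R| <= n%:R :> R.
  have h : m%:R <= n%:R :> R by rewrite ler_nat -ltnS ltnW.
  by rewrite distrC ger0_norm ?subr_ge0// gerBl.
apply: (le_trans (ler_pM _ _ nm IH)) => //.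
rewrite factS natrM exprMn (exprS _ m).
rewrite (_ : _ * (m.+1%:R * _) =
  (n%:R * ((lag_poly al n)`_0 * (n%:R ^+ m / m`!%:R ^+ 2))) * ((m%:R + al + 1) / m.+1%:R)); last first.
  have f0 : m`!%:R != 0 :> R by rewrite pnatr_eq0 -lt0n fact_gt0.
  move: f0 (lt0r_neq0 m1); move: (m`!%:R : R) (m.+1%:R : R) => f m1' f0 m0.
  by field; rewrite f0 m0.
rewrite ler_peMr//.
  by rewrite !mulr_ge0// ?(ltW L0)// ?exprn_ge0// ?invr_ge0 ?exprn_ge0.
by rewrite ler_pdivlMr// mul1r -natr1; lra.
Qed.

Lemma expR_series_ge (R : realType) (x : R) n : 0 <= x ->
  \sum_(i < n) x ^+ i / i`!%:R <= expR x.
Proof.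
move=> x0.
have nd : nondecreasing_seq (series (exp_coeff x)).
  apply/nondecreasing_seqP => k; rewrite seriesSr lerDl.
  by rewrite divr_ge0 ?exprn_ge0.
have := nondecreasing_cvgn_le nd (@is_cvg_series_exp_coeff R x) n.
by rewrite {1}/series/= big_mkord.
Qed.

Lemma horner_expR_bound (R : realType) (p : {poly R}) (B x t : R) : 0 <= x -> 0 <= t -> 0 <= B ->
  (forall m, `|p`_m| <= B * (x ^+ m / m`!%:R)) -> `|p.[t]| <= B * expR (x * t).
Proof.
move=> x0 t0 B0 Hp; rewrite horner_coef.
apply: (le_trans (ler_norm_sum _ _ _)).
apply: (@le_trans _ _ (B * \sum_(i < size p) (x * t) ^+ i / i`!%:R)); last first.
  by rewrite ler_wpM2l// expR_series_ge// mulr_ge0.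
rewrite mulr_sumr; apply: ler_sum => i _.
rewrite normrM [ `|t ^+ i| ]ger0_norm ?exprn_ge0// exprMn mulrAC mulrA.
by rewrite ler_wpM2r ?exprn_ge0.
Qed.

(** The upper half of [Gamma (n + al + 1) ~ n! n^al]. By induction it reduces to
    [(u + al) u^al <= v v^al] for [v = u + 1], which follows from [1 + al / v <= (v / u)^al]. *)
Lemma Gamma_le_fact (R : realType) (al : R) n : 0 <= al -> (0 < n)%N ->
  Gamma (n%:R + al + 1) <= n`!%:R * Gamma (al + 2) * n%:R `^ al.
Proof.
move=> al0; case: n => // n _; elim: n => [|n IH].
  by rewrite powR1 (factS 0) fact0 muln1 mulr1 mul1r (_ : 1 + al + 1 = al + 2)//; ring.
have n1 : 0 < n.+1%:R :> R by rewrite ltr0n.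
have n2 : 0 < n.+2%:R :> R by rewrite ltr0n.
rewrite Gamma_natS//.
apply: (@le_trans _ _ ((n.+1%:R + al + 1) * (n.+1`!%:R * Gamma (al + 2) * n.+1%:R `^ al))).
  by rewrite ler_wpM2l//; lra.
rewrite (factS n.+1) natrM.
suff h : (n.+1%:R + al + 1) * n.+1%:R `^ al <= n.+2%:R * n.+2%:R `^ al.
  have G0 : 0 <= n.+1`!%:R * Gamma (al + 2).
    by rewrite mulr_ge0// ltW// Gamma_gt0//; lra.
  apply: (le_trans (y := n.+1`!%:R * Gamma (al + 2) * ((n.+1%:R + al + 1) * n.+1%:R `^ al))).
    by rewrite mulrCA.
  by apply: (le_trans (ler_wpM2l G0 h)); rewrite !mulrA (mulrC _ n.+2%:R) !mulrA.
have ba : n.+2%:R = n.+1%:R + 1 :> R by rewrite natr1.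
move: (n.+1%:R : R) (n.+2%:R : R) n1 n2 ba => u v u0 v0 vu.
(* Inverse of [exp (- 1 / v) >= 1 - 1 / v = u / v]. *)
have e1 : expR v^-1 <= v / u.
  have := @expR_ge1Dx R (- v^-1); rewrite expRN => h.
  rewrite ler_pdivlMr// -ler_pdivlMl ?expR_gt0//.
  have := ler_wpM2r (ltW v0) h; rewrite mulrDl mulNr mulVf ?gt_eqF//; lra.
have e2 : 1 + al / v <= (v / u) `^ al.
  apply: (le_trans (expR_ge1Dx _)); rewrite mulrC expRM.
  by rewrite ge0_ler_powR ?nnegrE ?expR_ge0// divr_ge0// ltW.
have -> : v `^ al = u `^ al * (v / u) `^ al.
  by rewrite -powRM ?divr_ge0 ?(ltW u0) ?(ltW v0)// mulrCA divff ?mulr1 ?gt_eqF.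
rewrite mulrCA mulrC ler_wpM2l ?powR_ge0//.
have := ler_wpM2l (ltW v0) e2; rewrite mulrDr mulr1 mulrCA divff ?gt_eqF// mulr1; lra.
Qed.

(** Induction on the polynomial: a factor [t] moves from the polynomial into the power, which is why
    [a] must vary. *)
Lemma horner_powR_expR_bounded (R : realType) (p : {poly R}) (a : R) : 0 <= a ->
  exists C, forall t, 0 <= t -> t `^ a * expR (- (t / 2)) * `|p.[t]| <= C.
Proof.
elim/poly_ind: p a => [|p c IH] a a0.
  by exists 0 => t _; rewrite horner0 normr0 mulr0.
have [C1 H1] := IH (a + 1) (addr_ge0 a0 ler01).
have [K K0 HK] := powR_expR_bounded a0.
exists (C1 + K * `|c|) => t t0; rewrite !hornerE.
apply: (le_trans (ler_wpM2l _ (ler_normD _ _))); first by rewrite mulr_ge0 ?powR_ge0 ?expR_ge0.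
rewrite mulrDr lerD//; last by rewrite ler_wpM2r// HK.
apply: le_trans (H1 t t0); rewrite normrM (ger0_norm t0).
have [->|tN0] := eqVneq t 0; first by rewrite !mulr0 powR0 ?mul0r// gt_eqF//; lra.
rewrite powRD ?tN0 ?implybT// powRr1//.
by rewrite le_eqVlt; apply/orP; left; apply/eqP; ring.
Qed.

Lemma sqr_powR_half (R : realType) (t a : R) : (t `^ (a / 2)) ^+ 2 = t `^ a.
Proof.
by rewrite -powR_mulrn ?powR_ge0// -powRrM divfK// pnatr_eq0.
Qed.

Lemma sqrt_weight (R : realType) (al t : R) :
  Num.sqrt (weight al t) = t `^ (al / 2) * expR (- (t / 2)).
Proof.
have <- : (t `^ (al / 2) * expR (- (t / 2))) ^+ 2 = weight al t.
  rewrite exprMn sqr_powR_half /weight expr2 -expRD; congr (_ * expR _); lra.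
by rewrite sqrtr_sqr ger0_norm// mulr_ge0 ?powR_ge0 ?expR_ge0.
Qed.

(** * The orthonormal Laguerre functions are uniformly bounded *)

Section laguerre_function.
Context {R : realType} (al : R) (n : nat).
Hypothesis al0 : 0 <= al.
Let L := lag_poly al n.
Let a := Num.sqrt (n`!%:R / Gamma (n%:R + al + 1)).
Let k := n%:R + (al + 1) / 2.
Let w (t : R) := a * (t `^ (al / 2) * expR (- (t / 2))).
Let Y (t : R) := w t * L.[t].
Let Y1 (t : R) := w t * ((al / 2 - t / 2) * L.[t] + t * L^`().[t]).

Let dw (t : R) : 0 < t -> is_derive t 1 w ((al / 2 - t / 2) * w t / t).
Proof.
move=> t0; have tN0 : t != 0 by rewrite gt_eqF.
have dh : is_derive t 1 (fun t : R => - (t / 2)) (- 2^-1).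
  by apply: trigger_derive; rewrite /GRing.scale/=; lra.
have := is_derive_mul (is_derive_cst a t 1)
  (is_derive_mul (is_derive_powR_div (al / 2) t0) (is_derive_exp dh)).
by move=> /trigger_derive; apply; rewrite /cst /w; field.
Qed.

Let dY (t : R) : 0 < t -> is_derive t 1 Y (Y1 t / t).
Proof.
move=> t0; have tN0 : t != 0 by rewrite gt_eqF.
have := is_derive_mul (dw t0) (is_derive_poly L t).
by move=> /trigger_derive; apply; rewrite /Y1; field.
Qed.

Let dY1 (t : R) : 0 < t ->
  is_derive t 1 Y1 (- ((k * t - t ^+ 2 / 4 - al ^+ 2 / 4) * Y t) / t).
Proof.
move=> t0; have tN0 : t != 0 by rewrite gt_eqF.
have dl : is_derive t 1 (fun t : R => al / 2 - t / 2) (- 2^-1).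
  by apply: trigger_derive; rewrite /GRing.scale/=; lra.
have := is_derive_mul (dw t0) (is_derive_add (is_derive_mul dl (is_derive_poly L t))
  (is_derive_mul (is_derive_id t 1) (is_derive_poly L^`() t))).
move=> /trigger_derive; apply; rewrite (lag_poly_ode n t al0) -/L /Y /k.
by move: (w t) (L.[t]) (L^`().[t]) (n%:R : R) => w' l l' N; field.
Qed.

Let Ydecay : exists C, forall t : R, 0 < t -> t * `|Y t| <= C.
Proof.
have al20 : 0 <= al / 2 by rewrite divr_ge0.
have [C HC] := horner_powR_expR_bounded ('X * L) al20.
exists (a * C) => t t0; have a0 : 0 <= a by rewrite sqrtr_ge0.
rewrite /Y /w normrM ger0_norm; last by rewrite !mulr_ge0 ?powR_ge0 ?expR_ge0.
apply: le_trans (ler_wpM2l a0 (HC t (ltW t0))).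
by rewrite hornerM hornerX normrM (ger0_norm (ltW t0)) mulrCA !mulrA.
Qed.

Let k_gt0 : 0 < k. Proof. by rewrite /k ltr_wpDl//; move: al0; lra. Qed.

(** The normalization turns the left side into [Gamma (n + al + 1) / (n! Gamma (al + 1)^2)], which
    is of order [k^al] by [Gamma_le_fact]. The summand with [2^al] covers [n = 0], where
    [2 k = al + 1 >= 1]. *)
Let L0_le : a ^+ 2 * L`_0 ^+ 2 <=
  (Gamma (al + 2) + 2 `^ al * Gamma (al + 1)) / Gamma (al + 1) ^+ 2 * k `^ al.
Proof.
have G1 : 0 < Gamma (al + 1) by apply: Gamma_gt0; move: al0; lra.
have G2 : 0 < Gamma (al + 2) by apply: Gamma_gt0; move: al0; lra.
have Gn := Gamma_nat_gt0 n al0.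
have f0 : 0 < n`!%:R :> R by rewrite ltr0n fact_gt0.
have kal0 := powR_ge0 k al.
have hG : Gamma (n%:R + al + 1) <=
    (Gamma (al + 2) + 2 `^ al * Gamma (al + 1)) * k `^ al * n`!%:R.
  case: (posnP n) => [n0|n0].
    rewrite n0 fact0 mulr1 add0r.
    have h1 : 1 <= 2 `^ al * k `^ al.
      rewrite -powRM ?(ltW k_gt0)// -[leLHS](powRr0 (2 * k)) ler_powR//.
      by rewrite /k n0; move: al0; lra.
    move: G1 G2 kal0 h1.
    move: (Gamma (al + 1)) (Gamma (al + 2)) (k `^ al) (2 `^ al) => x y z u x0 y0 z0 h1.
    rewrite mulrDl; have := mulr_ge0 (ltW y0) z0; have := ler_wpM2l (ltW x0) h1; lra.
  have nk : n%:R `^ al <= k `^ al.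
    by rewrite ge0_ler_powR ?nnegrE ?(ltW k_gt0)// /k lerDl; move: al0; lra.
  have := Gamma_le_fact al0 n0; have u0 := powR_ge0 (2 : R) al.
  move: (f0) G1 G2 kal0 nk u0.
  move: (Gamma (al + 1)) (Gamma (al + 2)) (k `^ al) (2 `^ al) (n`!%:R : R) (n%:R `^ al).
  move=> x y z u f v {}f0 x0 y0 z0 vz u0 /le_trans; apply.
  rewrite [leRHS]mulrC mulrDl mulrDr -mulrA ler_wpDr//.
    by rewrite !mulr_ge0// ltW.
  by apply: (ler_wpM2l (ltW f0)); apply: (ler_wpM2l (ltW y0)).
have -> : a ^+ 2 = n`!%:R / Gamma (n%:R + al + 1).
  by apply: sqr_sqrtr; exact: divr_ge0 (ltW f0) (ltW Gn).
rewrite /L lag_poly_coef0.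
move: G1 G2 Gn f0 hG.
move: (Gamma (n%:R + al + 1)) (Gamma (al + 1)) (Gamma (al + 2)) (n`!%:R : R).
move=> g x y f x0 y0 g0 f0 hG.
rewrite (_ : _ * _ ^+ 2 = g / f / x ^+ 2); last by field; rewrite !gt_eqF.
rewrite [leRHS]mulrAC; apply: ler_wpM2r; first by rewrite invr_ge0 exprn_ge0// ltW.
by rewrite ler_pdivrMr.
Qed.

Let c := al ^+ 2 + 1.
Let G := (Gamma (al + 2) + 2 `^ al * Gamma (al + 1)) / Gamma (al + 1) ^+ 2.
(** In [Y1], the factor [al / 2 - t / 2] is at most [al / 2 + c] in absolute value, since [k t <= c]
    and [k >= 1/2] give [t <= 2 c]; the [1] accounts for the term [t L']. *)
Let d := al / 2 + c + 1.

Let G_ge0 : 0 <= G.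
Proof.
have G1 : 0 < Gamma (al + 1) by apply: Gamma_gt0; move: al0; lra.
have G2 : 0 < Gamma (al + 2) by apply: Gamma_gt0; move: al0; lra.
apply: divr_ge0 (exprn_ge0 _ (ltW G1)); apply: addr_ge0 (ltW G2) _.
exact: mulr_ge0 (powR_ge0 _ _) (ltW G1).
Qed.

(** As [n t <= c], comparison with the exponential series bounds [|L|] and [|t L'|] by [L_0 exp c],
    with [L_0] the constant coefficient. The remaining [a^2 L_0^2 t^al] is at most
    [G (k t)^al <= G c^al]. *)
Let Yinit (t : R) : 0 < t -> k * t <= c ->
  Y t ^+ 2 <= d ^+ 2 * expR c ^+ 2 * (G * c `^ al) /\
  Y1 t ^+ 2 <= d ^+ 2 * expR c ^+ 2 * (G * c `^ al).
Proof.
move=> t0 ktc; have c1 : 1 <= c by rewrite /c lerDr sqr_ge0.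
have d1 : 1 <= d by rewrite /d; move: al0; lra.
have n0 : 0 <= n%:R :> R by [].
have L0 : 0 <= L`_0 by rewrite ltW// lag_poly_coef0_gt0.
have ntc : n%:R * t <= c.
  by apply: le_trans ktc; rewrite ler_pM2r// /k lerDl; move: al0; lra.
have th : t <= 2 * c.
  have : 2^-1 * t <= k * t by rewrite ler_pM2r// /k; move: al0; lra.
  lra.
(* One of the two factorials in the coefficient bound absorbs the factor [m] produced by [t L']. *)
have coef_le m : n%:R ^+ m / m`!%:R ^+ 2 * m%:R <= n%:R ^+ m / m`!%:R :> R.
  rewrite -mulrA ler_wpM2l ?exprn_ge0//.
  have f0 : 0 < m`!%:R :> R by rewrite ltr0n fact_gt0.
  rewrite ler_pdivrMl ?exprn_gt0// expr2 mulfK ?gt_eqF// ler_nat.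
  by case: (m) => // m'; rewrite dvdn_leq ?fact_gt0// dvdn_fact//=.
have HL : `|L.[t]| <= L`_0 * expR c.
  apply: (le_trans (@horner_expR_bound R L (L`_0) n%:R t _ _ _ _)) => //; first exact: ltW.
    move=> m; apply: (le_trans (lag_poly_coef_le n m al0)).
    rewrite ler_wpM2l// ler_wpM2l ?exprn_ge0// lef_pV2 ?posrE ?exprn_gt0 ?ltr0n ?fact_gt0//.
    by rewrite expr2 ler_peMl// ler1n fact_gt0.
  by rewrite ler_wpM2l// ler_expR.
have HL' : `|t * L^`().[t]| <= L`_0 * expR c.
  have := @horner_expR_bound R ('X * L^`()) (L`_0) n%:R t n0 (ltW t0) L0.
  rewrite hornerM hornerX => h; apply: (le_trans (h _)); last by rewrite ler_wpM2l// ler_expR.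
  move=> m; rewrite coefXM coef_deriv; case: m => [|m] /=.
    by rewrite normr0 mulr_ge0.
  rewrite normrMn -(mulr_natr (`|_|) m.+1).
  apply: (le_trans (ler_wpM2r _ (lag_poly_coef_le n m.+1 al0))) => //.
  by rewrite -mulrA ler_wpM2l.
have S0 : 0 <= L`_0 * expR c by rewrite mulr_ge0 ?expR_ge0.
have HY : `|L.[t]| <= d * (L`_0 * expR c).
  by apply: (le_trans HL); rewrite ler_peMl.
have HY1 : `|(al / 2 - t / 2) * L.[t] + t * L^`().[t]| <= d * (L`_0 * expR c).
  apply: (le_trans (ler_normD _ _)); rewrite normrM /d mulrDl mul1r; apply: lerD => //.
  apply: ler_pM => //; rewrite ler_norml; apply/andP; split; move: al0; lra.
have key (x : R) : `|x| <= d * (L`_0 * expR c) ->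
    (w t * x) ^+ 2 <= d ^+ 2 * expR c ^+ 2 * (G * c `^ al).
  move=> Hx; have x2 : x ^+ 2 <= (d * (L`_0 * expR c)) ^+ 2.
    by rewrite -real_normK ?num_real// lerXn2r ?nnegrE// (le_trans _ Hx).
  have E1 : expR (- (t / 2)) ^+ 2 <= 1.
    by rewrite expr_le1 ?expR_ge0// expR_le1 oppr_le0 divr_ge0// ltW.
  rewrite /w !exprMn sqr_powR_half.
  apply: (@le_trans _ _ (a ^+ 2 * t `^ al * (d * (L`_0 * expR c)) ^+ 2)).
    apply: (ler_pM _ _ _ x2).
    - exact: (mulr_ge0 (sqr_ge0 _) (mulr_ge0 (powR_ge0 _ _) (sqr_ge0 _))).
    - exact: sqr_ge0.
    - by apply: (ler_wpM2l (sqr_ge0 _)); exact: (ler_piMr (powR_ge0 _ _) E1).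
  rewrite [leLHS](_ : _ = d ^+ 2 * expR c ^+ 2 * (a ^+ 2 * L`_0 ^+ 2 * t `^ al)); last by ring.
  apply: ler_wpM2l; first by rewrite mulr_ge0 ?sqr_ge0.
  apply: (le_trans (ler_wpM2r (powR_ge0 _ _) L0_le)).
  rewrite -[leLHS]mulrA; apply: (ler_wpM2l G_ge0); rewrite -powRM ?(ltW k_gt0) ?(ltW t0)//.
  rewrite ge0_ler_powR ?nnegrE ?mulr_ge0 ?(ltW k_gt0) ?(ltW t0)//.
  exact: le_trans ler01 c1.
by split; apply: key.
Qed.

Lemma laguerre_fun_bound (t : R) : 0 < t ->
  (laguerre_on al n t * Num.sqrt (weight al t)) ^+ 2 <=
    (4 + 2 * c) * (expR 1 * ((c + 2) * (d ^+ 2 * expR c ^+ 2 * (G * c `^ al)))).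
Proof.
move=> t0; rewrite (_ : _ * _ = Y t); last first.
  by rewrite /laguerre_on laguerreE sqrt_weight /Y /w -/L -/a; ring.
have B0 : 0 <= d ^+ 2 * expR c ^+ 2 * (G * c `^ al).
  exact: (mulr_ge0 (mulr_ge0 (sqr_ge0 _) (sqr_ge0 _)) (mulr_ge0 G_ge0 (powR_ge0 _ _))).
rewrite -(sqr_sqrtr B0).
have kal : (al + 1) / 2 <= k by rewrite /k lerDr.
apply: (laguerre_ode_bound al0 kal dY dY1 Ydecay _ t0).
by move=> u u0 kuc; rewrite (sqr_sqrtr B0); exact: Yinit.
Qed.

End laguerre_function.

Lemma laguerre_fun_uniform_bound (R : realType) (al : R) : 0 <= al ->
  exists2 B : R, 0 < B & forall n t, 0 < t ->
    `|laguerre_on al n t * Num.sqrt (weight al t)| <= B.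
Proof.
move=> al0; have [D HD] : exists D : R, forall n t, 0 < t ->
    (laguerre_on al n t * Num.sqrt (weight al t)) ^+ 2 <= D.
  (* The bound of [laguerre_fun_bound] is an expression in [al] alone. *)
  by eexists => n t t0; exact: laguerre_fun_bound.
have D0 : 0 <= D by apply: (le_trans _ (HD 0%N 1 ltr01)); exact: sqr_ge0.
exists (1 + D) => [|n t t0]; first by rewrite ltr_wpDr.
have := HD n t t0; move: (_ * _) => x h.
rewrite -(@ler_sqr _ _ (1 + D)) ?nnegrE ?addr_ge0// real_normK ?num_real//.
by apply: (le_trans h); rewrite sqrrD; have := sqr_ge0 D; lra.
Qed.

(** * Power-mean bounds on blocks of indices *)

(** A substitute for Hoelder's inequality at the cost of a factor 2: apply [x <= x^r + 1] to the
    rescaled terms [u k / la] and sum. *)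
Lemma le_sum_nat_powR (R : realType) (u : nat -> R) (A r : R) (m M : nat) :
  1 <= r -> 0 < A -> (forall k, 0 <= u k) ->
  \sum_(m <= k < m + M) u k `^ r <= A `^ r ->
  \sum_(m <= k < m + M) u k <= 2 * A * M%:R `^ (1 - r^-1).
Proof.
move=> r1 A0 u0; have r0 : 0 < r by apply: lt_le_trans r1.
case: M => [|M] Hu.
  by rewrite addn0 big_geq// mulr_ge0 ?powR_ge0// mulr_ge0// ltW.
have M0 : 0 < M.+1%:R :> R by rewrite ltr0n.
have MN0 : M.+1%:R != 0 :> R by rewrite gt_eqF.
have -> : M.+1%:R `^ (1 - r^-1) = M.+1%:R * M.+1%:R `^ (- r^-1) :> R.
  by rewrite powRD ?MN0 ?implybT// powRr1// ltW.
(* This scale balances the two sums: [la^r] is [A^r] divided by the length of the block, so each sum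
   is at most [la] times that length. *)
pose la := A * M.+1%:R `^ (- r^-1).
have la0 : 0 < la by rewrite mulr_gt0 ?powR_gt0.
have laE : la `^ r = A `^ r / M.+1%:R.
  rewrite powRM ?powR_ge0 ?(ltW A0)// -powRrM mulNr mulVf ?gt_eqF// powR_inv1//.
have laVE : la^-1 `^ r = M.+1%:R / A `^ r.
  rewrite -(powR_inv1 (ltW la0)) powRAC laE powR_inv1 ?invf_div//.
  by rewrite divr_ge0 ?powR_ge0.
have base (x : R) : 0 <= x -> x <= x `^ r + 1.
  move=> x0; have [x1|x1] := leP x 1; first by rewrite (le_trans x1)// lerDr powR_ge0.
  by rewrite (le_trans (le1r_powR (ltW x1) r1))// lerDl.
have ule k : u k <= la * (u k `^ r * (M.+1%:R / A `^ r) + 1).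
  rewrite -ler_pdivrMl// [leLHS]mulrC; apply: (le_trans (base _ _)).
    by rewrite divr_ge0// ltW.
  by rewrite lerD2r powRM ?invr_ge0 ?(ltW la0)// laVE.
apply: (le_trans (ler_sum _ (fun k _ => ule k))).
rewrite -mulr_sumr big_split/= -mulr_suml sumr_const_nat addKn.
rewrite (_ : 2 * A * _ = la * (M.+1%:R + M.+1%:R)); last by rewrite /la; ring.
rewrite ler_wpM2l ?(ltW la0)// lerD2r.
apply: (@le_trans _ _ (A `^ r * (M.+1%:R / A `^ r))).
  by rewrite ler_wpM2r// divr_ge0 ?powR_ge0// ltW.
by rewrite mulrCA divff ?mulr1// gt_eqF// powR_gt0.
Qed.

Lemma le_sum_nat_nneseries (R : realType) (v : nat -> R) (A r : R) (m n : nat) :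
  0 < r -> 0 <= A -> (forall k, 0 <= v k) ->
  ((\sum_(0 <= k <oo) (v k)%:E) `^ r^-1 <= A%:E)%E ->
  \sum_(m <= k < n) v k <= A `^ r.
Proof.
move=> r0 A0 v0 H.
have S0 : (0 <= \sum_(0 <= k <oo) (v k)%:E)%E by apply: nneseries_ge0 => k _ _; rewrite lee_fin.
have HS : (\sum_(0 <= k <oo) (v k)%:E <= (A `^ r)%:E)%E.
  have := @gt0_ler_poweR R r (ltW r0) _ _ _ _ H.
  rewrite poweR_EFin -poweRrM mulVf ?gt_eqF// poweRe1//; apply.
    by rewrite in_itv/= poweR_ge0 leey.
  by rewrite in_itv/= lee_fin A0 leey.
have [nm|mn] := leqP n m; first by rewrite big_geq// powR_ge0.
rewrite -lee_fin; apply: le_trans HS.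
apply: (le_trans _ (nneseries_lim_ge n _)); last by move=> k _ _; rewrite lee_fin.
rewrite sumEFin lee_fin (big_cat_nat (leq0n m) (ltnW mn))/= lerDr.
exact: sumr_ge0.
Qed.

Lemma recip_EFin (R : realType) (r : R) : recip r%:E = r^-1.
Proof. exact: fine_invr. Qed.

Lemma recipy (R : realType) : recip (+oo%E : \bar R) = 0.
Proof. by rewrite /recip invey. Qed.

(** A null set of the counting measure contains no point, so an essential bound holds at every
    index. *)
Lemma counting_ess_sup_le (R : realType) (f : nat -> \bar R) (y : \bar R) :
  (ess_sup (@counting nat R) f <= y)%E -> forall k, (f k <= y)%E.
Proof.
move=> /ess_supP[N [mN N0 subN]] k.
rewrite leNgt; apply/negP => fk.
have Nk : N k by apply: subN => /= h; move: fk; rewrite ltNge h.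
have : (@counting nat R [set k] <= @counting nat R N)%E.
  by apply: le_measure; rewrite ?inE// => x ->.
rewrite N0 /counting asboolT; last exact: finite_set1.
by rewrite fset_set1 finmap.cardfs1 lee_fin ler10.
Qed.

Lemma le_sum_nat_lp_norm (R : realType) (p : \bar R) (u : nat -> R) (A : R) (m M : nat) :
  (1 <= p)%E -> 0 < A -> (lp_norm p u <= A%:E)%E ->
  \sum_(m <= k < m + M) `|u k| <= 2 * A * M%:R `^ (1 - recip p).
Proof.
move=> p1 A0; case: p p1 => [r|_|//].
  rewrite lee_fin => r1; have r0 : 0 < r by apply: lt_le_trans r1.
  rewrite recip_EFin /lp_norm Lnorm_counting// => H.
  apply: le_sum_nat_powR => //.
  by apply: (le_sum_nat_nneseries _ _ r0 (ltW A0)) => // k; rewrite powR_ge0.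
rewrite recipy subr0 powRr1// /lp_norm unlock /Lnorm.body.
have -> : (0 < @counting nat R [set: nat])%E.
  by rewrite /counting asboolF//; exact: infinite_nat.
move=> /counting_ess_sup_le H.
apply: (@le_trans _ _ (\sum_(m <= k < m + M) A)).
  by apply: ler_sum_nat => k _; have := H k; rewrite /= lee_fin.
rewrite sumr_const_nat addKn -[leLHS]mulr_natr ler_wpM2r//.
by rewrite ler_peMl ?(ltW A0)// ler1n.
Qed.

Lemma le_sum_nat_W_norm (R : realType) (al : R) (s : \bar R) (mu : R) f (m M : nat) :
  (1 <= s)%E -> (W_norm al s mu f <= 1)%E ->
  \sum_(m <= k < m + M) (maxn 1 k)%:R `^ mu * `|FL_coef al f k| <=
    2 * M%:R `^ (1 - recip s).
Proof.
case: s => [r|_|//].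
  rewrite lee_fin => r1; have r0 : 0 < r by apply: lt_le_trans r1.
  rewrite recip_EFin /W_norm => H.
  rewrite -[2]mulr1; apply: le_sum_nat_powR => //.
  apply: (le_sum_nat_nneseries _ _ r0 ler01) => [k|]; first exact: powR_ge0.
  apply: le_trans H; rewrite le_eqVlt; apply/orP; left; apply/eqP; congr (_ `^ _)%E.
  apply: eq_eseriesr => k _; congr (_%:E).
  by rewrite powRM ?powR_ge0// -powRrM (mulrC r).
rewrite recipy subr0 powRr1// /W_norm => H.
apply: (@le_trans _ _ (\sum_(m <= k < m + M) 1)).
  apply: ler_sum_nat => k _; rewrite -lee_fin; apply: le_trans H.
  by apply: ereal_sup_ubound; exists k.
by rewrite sumr_const_nat addKn ler_peMl// ler1n.
Qed.

Lemma powR_gt1 (R : realType) (a e : R) : 1 < a -> 0 < e -> 1 < a `^ e.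
Proof.
move=> a1 e0; have a0 : 0 < a := lt_trans ltr01 a1.
by rewrite /powR gt_eqF// expR_gt1 mulr_gt0// ln_gt0.
Qed.

(** * Summation over dyadic blocks *)

Section dyadic_sums.
Context {R : realType} (x : nat -> R) (mu q : R).
Hypothesis x0 : forall k, 0 <= x k.
Hypothesis mu0 : 0 <= mu.
Hypothesis Hblock : forall m M,
  \sum_(m <= k < m + M) (maxn 1 k)%:R `^ mu * x k <= 2 * M%:R `^ (1 - q).
Let sg := mu + q - 1.

(** On the block from [m] to [2 m] the weight is at least [m^mu], so [Hblock] may be divided by
    it. *)
Let dyadic_block_le m : (0 < m)%N ->
  \sum_(m <= k < m + m) x k <= 2 * m%:R `^ (- sg).
Proof.
move=> m0; have m0' : 0 < m%:R :> R by rewrite ltr0n.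
have mp : 0 < m%:R `^ mu :> R by rewrite powR_gt0.
rewrite -(ler_pM2l mp) [leRHS]mulrCA -powRD; last by rewrite (gt_eqF m0') implybT.
rewrite (_ : mu + - sg = 1 - q); last by rewrite /sg; ring.
apply: le_trans (Hblock m m); rewrite mulr_sumr; apply: ler_sum_nat => k /andP[mk _].
rewrite ler_wpM2r// ge0_ler_powR ?nnegrE// ler_nat.
by rewrite (leq_trans mk) // leq_maxr.
Qed.

Let powR_expn (e : R) i : (2 ^ i)%:R `^ e = (2 `^ e) ^+ i.
Proof. by rewrite natrX -powR_mulrn// powRAC powR_mulrn ?powR_ge0. Qed.

(** The blocks from [2^i N] to [2^(i+1) N] contribute a geometric series of ratio [rho < 1]. *)
Lemma sum_tail_le N n : 0 < sg -> (0 < N)%N ->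
  \sum_(N <= k < n) x k <= 2 / (1 - 2 `^ (- sg)) * N%:R `^ (- sg).
Proof.
move=> sg0 N0; set rho := 2 `^ (- sg).
have rho0 : 0 < rho by rewrite powR_gt0.
have rho1 : rho < 1 by rewrite /rho powRN invf_lt1 ?powR_gt0// powR_gt1// ltr1n.
have geo i : \sum_(N <= k < 2 ^ i * N) x k <=
    2 * N%:R `^ (- sg) * ((1 - rho ^+ i) / (1 - rho)).
  elim: i => [|i IH].
    by rewrite expn0 mul1n big_geq// expr0 subrr mul0r mulr0.
  have iN : (0 < 2 ^ i * N)%N by rewrite muln_gt0 expn_gt0.
  have -> : (2 ^ i.+1 * N = 2 ^ i * N + 2 ^ i * N)%N by rewrite expnS -mulnA mul2n addnn.
  rewrite (@big_cat_nat _ _ _ (2 ^ i * N)) ?leq_addr//=; last by rewrite leq_pmull// expn_gt0.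
  apply: (le_trans (lerD IH (dyadic_block_le iN))).
  rewrite natrM powRM// powR_expn -/rho exprS.
  have r1 : 1 - rho != 0 by rewrite subr_eq0 gt_eqF.
  by rewrite le_eqVlt; apply/orP; left; apply/eqP; field.
have nN : (n <= 2 ^ n * N)%N by rewrite (leq_trans (ltnW (ltn_expl n (ltnSn 1))))// leq_pmulr.
have [Nn|nN'] := leqP N n; last first.
  by rewrite big_geq ?(ltnW nN')// mulr_ge0 ?powR_ge0// divr_ge0// subr_ge0 ltW.
apply: (@le_trans _ _ (\sum_(N <= k < 2 ^ n * N) x k)).
  by rewrite [leRHS](@big_cat_nat _ _ _ n)//= lerDl sumr_ge0.
apply: (le_trans (geo n)).
rewrite (_ : 2 / _ * _ = 2 * N%:R `^ (- sg) * (1 / (1 - rho))); last by ring.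
rewrite ler_wpM2l ?mulr_ge0 ?powR_ge0// ler_wpM2r// ?invr_ge0 ?subr_ge0 ?(ltW rho1)//.
by rewrite gerBl exprn_ge0// ltW.
Qed.

(** On the block from [2^J] to [2^(J+1)] the weighted sum is of order [tau^J] with [tau > 1], so the
    last block dominates and yields [N^(th - sg)]. *)
Lemma sum_head_le th N : 0 < th -> sg < th -> (0 < N)%N ->
  \sum_(0 <= k < N.+1) (k%:R / N%:R) `^ th * x k <=
    2 * 2 `^ th / (2 `^ (th - sg) - 1) * 2 `^ (th - sg) * N%:R `^ (- sg).
Proof.
move=> th0 sgth N0; set tau := 2 `^ (th - sg).
have tau1 : 1 < tau by rewrite powR_gt1 ?ltr1n// subr_gt0.
have tau0 : 0 < tau := lt_trans ltr01 tau1.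
have geo J : \sum_(1 <= k < 2 ^ J) k%:R `^ th * x k <= 2 * 2 `^ th * ((tau ^+ J - 1) / (tau - 1)).
  elim: J => [|J IH].
    by rewrite expn0 big_geq// expr0 subrr mul0r mulr0.
  have J0 : (0 < 2 ^ J)%N by rewrite expn_gt0.
  have E2 : (2 ^ J.+1 = 2 ^ J + 2 ^ J)%N by rewrite expnS mul2n addnn.
  rewrite E2 (@big_cat_nat _ _ _ (2 ^ J)) ?leq_addr//=.
  have : \sum_(2 ^ J <= k < 2 ^ J + 2 ^ J) k%:R `^ th * x k <= 2 * 2 `^ th * tau ^+ J.
    apply: (@le_trans _ _ (\sum_(2 ^ J <= k < 2 ^ J + 2 ^ J) (2 ^ J.+1)%:R `^ th * x k)).
      apply: ler_sum_nat => k /andP[_ kJ]; rewrite ler_wpM2r// ge0_ler_powR ?nnegrE ?(ltW th0)//.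
      by rewrite ler_nat E2 ltnW.
    rewrite -mulr_sumr; apply: (le_trans (ler_wpM2l (powR_ge0 _ _) (dyadic_block_le J0))).
    rewrite !powR_expn exprS /tau powRD ?pnatr_eq0 ?implybT// exprMn.
    by rewrite le_eqVlt; apply/orP; left; apply/eqP; ring.
  move/(lerD IH)/le_trans; apply.
  have r1 : tau - 1 != 0 by rewrite subr_eq0 gt_eqF.
  by rewrite exprS le_eqVlt; apply/orP; left; apply/eqP; field.
have NN0 : 0 < N%:R :> R by rewrite ltr0n.
(* The index 0 has weight [0^th = 0], so the blocks may start at 1. *)
rewrite big_nat_recl// mul0r powR0 ?gt_eqF// mul0r add0r.
have -> : \sum_(0 <= i < N) (i.+1%:R / N%:R) `^ th * x i.+1 =
    N%:R `^ (- th) * \sum_(1 <= k < N.+1) k%:R `^ th * x k.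
  rewrite mulr_sumr big_add1/=; apply: eq_bigr => i _.
  by rewrite powRM ?invr_ge0// -(powR_inv1 (ltW NN0)) -powRrM mulN1r mulrCA mulrA.
(* [2^J] is the first power of 2 above [N]; as [2^(J-1) <= N], rounding up costs the extra factor
   [tau]. *)
have /andP[J1 J2] := trunc_log_bounds (ltnSn 1) N0.
set J := (trunc_log 2 N).+1 in J2.
have H1 : \sum_(1 <= k < N.+1) k%:R `^ th * x k <= 2 * 2 `^ th * (tau ^+ J / (tau - 1)).
  apply: (@le_trans _ _ (\sum_(1 <= k < 2 ^ J) k%:R `^ th * x k)).
    rewrite [leRHS](@big_cat_nat _ _ _ N.+1)//= lerDl sumr_ge0// => k _.
    by rewrite mulr_ge0 ?powR_ge0.
  apply: (le_trans (geo J)); rewrite ler_wpM2l ?mulr_ge0 ?powR_ge0//.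
  by rewrite ler_wpM2r ?invr_ge0 ?subr_ge0 ?(ltW tau1)// gerBl.
have H2 : tau ^+ J <= tau * N%:R `^ (th - sg).
  rewrite exprS ler_wpM2l ?(ltW tau0)// -powR_expn ge0_ler_powR ?nnegrE//.
    by rewrite subr_ge0 ltW.
  by rewrite ler_nat.
apply: (le_trans (ler_wpM2l (powR_ge0 _ _) H1)).
have -> : N%:R `^ (- sg) = N%:R `^ (- th) * N%:R `^ (th - sg) :> R.
  by rewrite -powRD ?(gt_eqF NN0) ?implybT//; congr (_ `^ _); ring.
rewrite [leRHS](_ : _ = N%:R `^ (- th) * (2 * 2 `^ th * (tau * N%:R `^ (th - sg) / (tau - 1)))); last by ring.
rewrite ler_wpM2l ?powR_ge0// ler_wpM2l ?mulr_ge0 ?powR_ge0//.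
by rewrite ler_wpM2r ?invr_ge0 ?subr_ge0 ?(ltW tau1).
Qed.
End dyadic_sums.

(** * Splitting of the error and choice of the constants *)

Lemma normr_lim_series_sub_le (R : realType) (x fd e nv : nat -> R) (N : nat) (B E1 E2 E3 : R) :
  0 <= B -> (forall k, `|e k| <= B) ->
  \sum_(0 <= k < N.+1) `|1 - nv k| * `|x k| <= E1 ->
  \sum_(0 <= k < N.+1) `|nv k| * `|x k - fd k| <= E2 ->
  (forall n, \sum_(N <= k < n) `|x k| <= E3) ->
  `|limn (series (fun k => x k * e k)) - \sum_(0 <= k < N.+1) nv k * fd k * e k|
    <= B * (E1 + E2 + E3).
Proof.
move=> B0 eB H1 H2 H3; set u := series _; set S := \sum_(_ <= _ < _) _.
have xe k : `|x k * e k| <= B * `|x k| by rewrite normrM mulrC ler_wpM2r.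
(* The value of [limn] is informative only for a convergent sequence; bounded partial sums of
   [|x k|] give absolute convergence. *)
have cu : cvgn u.
  apply: normed_cvg; apply: nondecreasing_is_cvgn.
    by apply/nondecreasing_seqP => n; rewrite /= /series/= big_nat_recr//= lerDl.
  exists (B * (\sum_(0 <= k < N) `|x k| + E3)) => _ [n _ <-] /=.
  apply: (@le_trans _ _ (\sum_(0 <= k < n) B * `|x k|)).
    by apply: ler_sum_nat => k _; exact: xe.
  rewrite -mulr_sumr ler_wpM2l//.
  have [nN|Nn] := leqP n N.
    apply: ler_wpDr; first by have := H3 0%N; rewrite big_geq.
    by rewrite [leRHS](@big_cat_nat _ _ _ n)//= lerDl sumr_ge0.
  by rewrite (@big_cat_nat _ _ _ N)//= ?(ltnW Nn)// lerD2l.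
have key n : (N.+1 <= n)%N -> `|u n - S| <= B * (E1 + E2 + E3).
  move=> Nn; rewrite /u /series/= (@big_cat_nat _ _ _ N.+1)//= addrAC.
  rewrite mulrDr; apply: (le_trans (ler_normD _ _)); apply: lerD; last first.
    apply: (le_trans (ler_norm_sum _ _ _)).
    apply: (le_trans (ler_sum _ (fun k _ => xe k))); rewrite -mulr_sumr ler_wpM2l//.
    by apply: le_trans (H3 n); rewrite [leRHS](@big_cat_nat _ _ _ N.+1)//= lerDr sumr_ge0.
  rewrite /S -sumrB; apply: (le_trans (ler_norm_sum _ _ _)).
  apply: (@le_trans _ _ (\sum_(0 <= k < N.+1) B * (`|1 - nv k| * `|x k| + `|nv k| * `|x k - fd k|))).
    apply: ler_sum_nat => k _; rewrite -mulrBl normrM mulrC.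
    apply: ler_pM => //; rewrite -!normrM.
    rewrite (_ : x k - nv k * fd k = (1 - nv k) * x k + nv k * (x k - fd k)); last by ring.
    exact: ler_normD.
  by rewrite -mulr_sumr ler_wpM2l// big_split/= lerD.
rewrite ler_distl; apply/andP; split.
  apply: limr_ge => //; near=> n; have : `|u n - S| <= B * (E1 + E2 + E3).
    by apply: key; near: n; exists N.+1.
  by rewrite ler_distl => /andP[].
apply: limr_le => //; near=> n; have : `|u n - S| <= B * (E1 + E2 + E3).
  by apply: key; near: n; exists N.+1.
by rewrite ler_distl => /andP[].
Unshelve. all: by end_near. Qed.

Lemma recip_ge0_le1 (R : realType) (p : \bar R) : (1 <= p)%E -> 0 <= recip p <= 1.
Proof.
case: p => [r|_|//]; last by rewrite recipy lexx ler01.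
rewrite lee_fin recip_EFin => r1; rewrite invr_ge0 (le_trans ler01)//=.
by rewrite invf_le1// (lt_le_trans ltr01).
Qed.

Lemma ler_powRN (R : realType) (e x y : R) : 0 <= e -> 0 < x -> x <= y ->
  y `^ (- e) <= x `^ (- e).
Proof.
move=> e0 x0 xy; have y0 := lt_le_trans x0 xy.
by rewrite !powRN lef_pV2 ?posrE ?powR_gt0// ge0_ler_powR ?nnegrE// ltW.
Qed.

(** The right side is free of [e], which keeps the constants of the theorem independent of [p]. *)
Lemma powR_le_1D (R : realType) (b e : R) : 0 < b -> 0 <= e <= 1 -> b `^ e <= 1 + b.
Proof.
move=> b0 /andP[e0 e1]; have [b1|b1] := leP b 1.
  apply: (@le_trans _ _ 1); last by rewrite lerDl ltW.
  by rewrite -[leRHS](powRr0 b) ger_powR// b0.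
apply: (@le_trans _ _ b); last by rewrite lerDr.
by rewrite -[leRHS](powRr1 (ltW b0)) ler_powR// ltW.
Qed.

Theorem theorem2p4 (R : realType) (alpha mu theta C a b : R) (s : \bar R)
    (halpha : 0 <= alpha) (hs : (1 <= s)%E)
    (hmus : 1 - recip s < mu) (hmu : 0 < mu)
    (htheta : 0 < theta) (hthetamu : mu + recip s - 1 < theta)
    (hC : 0 < C) (ha : 0 < a) (hab : a <= b) :
  exists c c1 c2 : R, [/\ 0 < c, 0 < c1, 0 < c2 &
    forall (p : \bar R) (delta : R) (N : nat),
      (1 <= p)%E -> 0 < delta -> delta < 1 -> (1 <= N)%N ->
      a * delta `^ (- (1 / (mu - recip p + recip s))) <= N%:R ->
      N%:R <= b * delta `^ (- (1 / (mu - recip p + recip s))) ->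
      (forall (nu : nat -> nat -> R) (f : R -> R) (fd : nat -> R),
        class_S theta C nu ->
        W alpha s mu f -> (W_norm alpha s mu f <= 1)%E ->
        (lp_norm p (fun k => (FL_coef alpha f k - fd k)%R) <= delta%:E)%E ->
        (normC (fun t => (cont_rep alpha f t
                  - S_method alpha nu N fd t * Num.sqrt (weight alpha t))%R)
          <= (c * delta `^ ((mu + recip s - 1) / (mu - recip p + recip s)))%:E)%E)
      /\ delta `^ ((mu + recip s - 1) / (mu - recip p + recip s))
           <= c1 * N%:R `^ (- mu - recip s + 1)
      /\ N%:R `^ (- mu - recip s + 1)
           <= c2 * delta `^ ((mu + recip s - 1) / (mu - recip p + recip s))].
Proof.
have q01 := recip_ge0_le1 hs.
set q := recip s in q01 hmus hthetamu *.
pose sg := mu + q - 1.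
have sg0 : 0 < sg by rewrite /sg; move: hmus; lra.
have sgth : sg < theta by exact: hthetamu.
have [B B0 HB] := laguerre_fun_uniform_bound halpha.
have b0 : 0 < b := lt_le_trans ha hab.
pose C1 := 2 * 2 `^ theta / (2 `^ (theta - sg) - 1) * 2 `^ (theta - sg).
pose C2 := 2 / (1 - 2 `^ (- sg)).
have C1_0 : 0 <= C1.
  rewrite /C1 mulr_ge0 ?powR_ge0// divr_ge0 ?mulr_ge0 ?powR_ge0// subr_ge0 ltW//.
  by rewrite powR_gt1 ?ltr1n// subr_gt0.
have C2_0 : 0 <= C2.
  by rewrite /C2 divr_ge0// subr_ge0 powRN invf_le1 ?powR_gt0// ltW// powR_gt1// ltr1n.
pose c2 := a `^ (- sg).
have c2_0 : 0 < c2 by rewrite powR_gt0.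
(* The three summands belong to the truncation factors [1 - nu], the noise and the tail; none
   involves [p]. *)
pose c := B * ((C * C1) * c2 + (1 + C) * (4 * (1 + b)) + C2 * c2).
have c0 : 0 < c.
  rewrite mulr_gt0//; apply: ltr_wpDr; first by rewrite mulr_ge0// ltW.
  apply: ltr_wpDl; first exact: (mulr_ge0 (mulr_ge0 (ltW hC) C1_0) (ltW c2_0)).
  by rewrite !mulr_gt0// addr_gt0.
exists c, (b `^ sg), c2; split => //; first by rewrite powR_gt0.
move=> p delta N p1 d0 d1 N1 aN Nb.
have /andP[rp0 rp1] := recip_ge0_le1 p1.
set rp := recip p in rp0 rp1 aN Nb *.
pose d := mu - rp + q; have dE : d = sg + (1 - rp) by rewrite /d /sg; ring.
have d_gt0 : 0 < d by rewrite dE ltr_wpDr// subr_ge0.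
have dN0 : d != 0 by rewrite gt_eqF.
rewrite -/d in aN Nb *.
(* In terms of [X] the assumption on [N] is [a X <= N <= b X], and the target rate is [X^(- sg)].
   The noise level [delta X^(1 - 1/p)] has exactly this size, which is the balance behind the choice
   of [N]. *)
pose X := delta `^ (- (1 / d)); rewrite -/X in aN Nb.
have X0 : 0 < X by rewrite powR_gt0.
have N0 : 0 < N%:R :> R by rewrite ltr0n.
have XE : delta `^ (sg / d) = X `^ (- sg).
  by rewrite /X -powRrM; congr (_ `^ _); field.
have Xrp : X `^ (1 - rp) * delta = X `^ (- sg).
  have dX : delta = X `^ (- d).
    by rewrite /X -powRrM (_ : - (1 / d) * - d = 1) ?powRr1 ?(ltW d0)//; field.
  transitivity (X `^ (1 - rp) * X `^ (- d)); first by congr (_ * _).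
  rewrite -powRD; last by rewrite (gt_eqF X0) implybT.
  by congr (_ `^ _); rewrite dE; ring.
have NXc2 : N%:R `^ (- sg) <= c2 * X `^ (- sg).
  rewrite /c2 -powRM ?(ltW ha) ?(ltW X0)//.
  by apply: ler_powRN => //; [exact: ltW|exact: mulr_gt0].
rewrite -/sg XE (_ : - mu - q + 1 = - sg); last by rewrite /sg; ring.
split; last first.
  split => //.
  have -> : X `^ (- sg) = b `^ sg * (b * X) `^ (- sg).
    by rewrite powRM ?(ltW b0) ?(ltW X0)// mulrA (powRN b) mulfV ?mul1r// gt_eqF// powR_gt0.
  by rewrite ler_wpM2l ?powR_ge0//; apply: ler_powRN => //; exact: ltW.
move=> nu f fd hnu hf hf1 hfd.
rewrite /normC; apply: ge_ereal_sup => y [t]; rewrite /posR /= in_itv/= andbT => t0 <-; rewrite lee_fin.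
pose e k := laguerre_on alpha k t * Num.sqrt (weight alpha t).
have -> : cont_rep alpha f t = limn (series (fun k => FL_coef alpha f k * e k)).
  by rewrite /cont_rep /e; under eq_fun do rewrite -mulrA.
have -> : S_method alpha nu N fd t * Num.sqrt (weight alpha t) =
    \sum_(0 <= k < N.+1) nu N k * fd k * e k.
  by rewrite /S_method mulr_suml; apply: eq_bigr => k _; rewrite /e mulrA.
have eB k : `|e k| <= B by exact: HB.
have xW m M := @le_sum_nat_W_norm R alpha s mu f m M hs hf1.
have xn k : 0 <= `|FL_coef alpha f k| by [].
have nuC k : (k <= N)%N -> `|1 - nu N k| <= C.
  move=> kN; apply: (le_trans (hnu N k N1 kN)); rewrite ler_piMr ?(ltW hC)//.
  have [->|k0] := posnP k; first by rewrite mul0r powR0 ?gt_eqF.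
  rewrite -[leRHS](powRr0 (k%:R / N%:R)) ger_powR ?(ltW htheta)//.
  by rewrite divr_gt0 ?ltr0n// ler_pdivrMr// mul1r ler_nat.
have T1 : \sum_(0 <= k < N.+1) `|1 - nu N k| * `|FL_coef alpha f k| <= C * (C1 * N%:R `^ (- sg)).
  apply: (@le_trans _ _ (\sum_(0 <= k < N.+1) C * ((k%:R / N%:R) `^ theta * `|FL_coef alpha f k|))).
    apply: ler_sum_nat => k /andP[_ kN]; rewrite mulrA ler_wpM2r//.
    exact: hnu.
  rewrite -mulr_sumr ler_wpM2l ?(ltW hC)//.
  exact: (sum_head_le xn (ltW hmu) xW htheta sgth N1).
have T3 n : \sum_(N <= k < n) `|FL_coef alpha f k| <= C2 * N%:R `^ (- sg).
  exact: (sum_tail_le xn (ltW hmu) xW n sg0 N1).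
(* Here [|nu| <= 1 + C]. The 4 is the 2 of the power-mean bound times a 2 from [N + 1 <= 2 N], and
   [1 + b] bounds [b^(1 - 1/p)] for every [p]. *)
have T2 : \sum_(0 <= k < N.+1) `|nu N k| * `|FL_coef alpha f k - fd k| <=
    (1 + C) * (4 * (1 + b) * X `^ (- sg)).
  apply: (@le_trans _ _ (\sum_(0 <= k < N.+1) (1 + C) * `|FL_coef alpha f k - fd k|)).
    apply: ler_sum_nat => k /andP[_ kN]; rewrite ler_wpM2r//.
    have := ler_normB 1 (1 - nu N k); rewrite opprB addrC subrK normr1 => /le_trans; apply.
    by rewrite lerD2l nuC.
  rewrite -mulr_sumr ler_wpM2l ?addr_ge0 ?(ltW hC)//.
  apply: (le_trans (@le_sum_nat_lp_norm R p _ delta 0 N.+1 p1 d0 hfd)); rewrite -/rp.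
  have e01 : 0 <= 1 - rp <= 1 by rewrite subr_ge0 rp1 gerBl.
  have e0 : 0 <= 1 - rp by case/andP: e01.
  have h2 : N.+1%:R `^ (1 - rp) <= 2 * ((1 + b) * X `^ (1 - rp)).
    apply: (@le_trans _ _ ((2 * (b * X)) `^ (1 - rp))).
      rewrite ge0_ler_powR ?nnegrE ?mulr_ge0 ?(ltW b0) ?(ltW X0)//.
      apply: (@le_trans _ _ (2 * N%:R)); last by rewrite ler_wpM2l.
      by rewrite -natrM ler_nat mul2n -addnn -addn1 leq_add2l.
    rewrite powRM ?mulr_ge0 ?(ltW b0) ?(ltW X0)// powRM ?(ltW b0) ?(ltW X0)//.
    apply: ler_pM; rewrite ?mulr_ge0 ?powR_ge0//.
      by case/andP: e01 => _ e1; rewrite ler1_powR// ler1n.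
    by rewrite ler_wpM2r ?powR_ge0// powR_le_1D.
  rewrite -Xrp; apply: (le_trans (ler_wpM2l _ h2)); first by rewrite mulr_ge0// ltW.
  by rewrite le_eqVlt; apply/orP; left; apply/eqP; ring.
apply: (le_trans (normr_lim_series_sub_le (ltW B0) eB T1 T2 T3)).
rewrite [leRHS](_ : _ = B * (C * (C1 * (c2 * X `^ (- sg))) +
  (1 + C) * (4 * (1 + b) * X `^ (- sg)) + C2 * (c2 * X `^ (- sg)))); last by rewrite /c; ring.
apply: (ler_wpM2l (ltW B0)); apply: lerD; last exact: (ler_wpM2l C2_0).
by apply: lerD => //; apply: (ler_wpM2l (ltW hC)); exact: (ler_wpM2l C1_0).
Qed.
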